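(* Let $K$ be a field of characteristic zero, $R = K[x_1,\dots,x_n]$, and let $f \in R$ be a product of polynomials of degree one, no two of which are proportional. Let $\mathcal{A}$ be the hyperplane arrangement in the affine space $V = K^n$ defined by $f$, that is, the set of the zero hyperplanes of the degree-one factors of $f$. Then the length of the first local cohomology group $H^1_{(f)}(R) = R[f^{-1}]/R$ as a left module over the $n$-th Weyl algebra $D_n$ satisfies $$\mathrm{length}\, H^1_{(f)}(R) = \pi(\mathcal{A},1) - 1 = \sum_{X \in L(\mathcal{A})\setminus\{V\}} |\mu(X)|,$$ where $L(\mathcal{A})$ is the intersection poset of $\mathcal{A}$, $\mu$ its Möbius function, and $\pi(\mathcal{A},t)$ the Poincaré polynomial of $\mathcal{A}$.
   Context: The $n$-th Weyl algebra $D_n = R\langle \partial_1,\dots,\partial_n\rangle$ is the ring of differential operators with coefficients in $R = K[x_1,\dots,x_n]$, where $\partial_i = \partial/\partial x_i$. The localization $R[f^{-1}]$ is a left $D_n$-module by the usual differentiation of fractions, with submodule $R$, and $H^1_{(f)}(R) = R[f^{-1}]/R$ is the quotient left $D_n$-module (it is holonomic). The length of a left $D_n$-module $M$ is the length $k$ of a composition series $M = M_0 \supset M_1 \supset \cdots \supset M_k = 0$ by left $D_n$-submodules with all successive quotients nonzero and simple. The intersection poset $L(\mathcal{A})$ is the set of all non-empty intersections of elements of $\mathcal{A}$, including $V$ itself (the intersection of the empty family), ordered by $X \le Y$ if and only if $X \supset Y$. The Möbius function is defined recursively by $\mu(X,X) = 1$, $\mu(X,Y) = -\sum_{X \le Z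 < Y}\mu(X,Z)$ if $X < Y$, and $\mu(X,Y) = 0$ otherwise. Set $\mu(X) = \mu(V,X)$. The Poincaré polynomial is $\pi(\mathcal{A},t) = \sum_{X \in L(\mathcal{A})} \mu(X)(-t)^{\mathrm{codim}\, X}$, where $\mathrm{codim}\, X$ is the codimension of the affine subspace $X$ in $V$. *)

(* Defs.v *)
From HB Require Import structures.
From mathcomp Require Import all_boot all_order all_algebra finmap.
From mathcomp Require Import generic_quotient ring_quotient fraction ring.
From mathcomp Require Import mpoly.
From mathcomp Require Import boolp classical_sets.

Set Implicit Arguments.
Unset Strict Implicit.
Unset Printing Implicit Defensive.

Import Order.TTheory GRing.Theory Num.Theory.

Local Open Scope ring_scope.
Local Open Scope quotient_scope.

Record submodule (D : nzRingType) (M : lmodType D) := Submodule {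
  carrier :> {pred M};
  carrier_closed : GRing.submod_closed carrier
}.

Section Submodules.
Variables (D : nzRingType) (M : lmodType D).

HB.instance Definition _ (N : submodule M) :=
  GRing.isSubmodClosed.Build D M (carrier N)
    (GRing.submod_closed_semi (carrier_closed N)).

Record submod_sort (N : submodule M) :=
  SubElt { submod_val : M; _ : submod_val \in carrier N }.

HB.instance Definition _ N := [isSub for @submod_val N].
HB.instance Definition _ N := [Choice of submod_sort N by <:].
HB.instance Definition _ N := [SubChoice_isSubLmodule of submod_sort N by <:].

Definition quotmod (N : submodule M) : Type := Quotient.quot (carrier N).

HB.instance Definition _ N := GRing.Zmodule.on (quotmod N).

Definition qmscale N (a : D) (x : quotmod N) : quotmod N :=
  \pi_(Quotient.quot (carrier N)) (a *: repr x).

Lemma qmscale_pi N a x :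
  qmscale a (\pi_(Quotient.quot (carrier N)) x : quotmod N) =
  \pi_(Quotient.quot (carrier N)) (a *: x).
Proof.
apply/eqP; rewrite -Quotient.idealrBE -scalerBr rpredZ //.
by rewrite Quotient.idealrBE reprK.
Qed.

Lemma quotmodW N (P : quotmod N -> Prop) :
  (forall y : M, P (\pi_(Quotient.quot (carrier N)) y)) -> forall x, P x.
Proof. exact: quotW. Qed.

Lemma qmscaleA N a b (x : quotmod N) :
  qmscale a (qmscale b x) = qmscale (a * b) x.
Proof. by elim/quotmodW: x => x; rewrite !qmscale_pi scalerA. Qed.

Lemma qmscale1 N : left_id 1 (@qmscale N).
Proof. by elim/quotmodW => x; rewrite qmscale_pi scale1r. Qed.

Lemma qmscaleDr N : right_distributive (@qmscale N) +%R.
Proof.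
move=> a; elim/quotmodW => x; elim/quotmodW => y.
rewrite -[_ + _](raddfD (\pi_(Quotient.quot (carrier N)))) !qmscale_pi.
by rewrite scalerDr raddfD.
Qed.

Lemma qmscaleDl N x : {morph (@qmscale N)^~ x : a b / a + b}.
Proof.
by elim/quotmodW: x => x a b; rewrite !qmscale_pi scalerDl raddfD.
Qed.

HB.instance Definition _ N := GRing.Zmodule_isLmodule.Build D (quotmod N)
  (@qmscaleA N) (@qmscale1 N) (@qmscaleDr N) (@qmscaleDl N).

Lemma restrict_closed (N N' : submodule M) :
  GRing.submod_closed [pred x : submod_sort N | val x \in carrier N'].
Proof.
split=> [|a x y]; rewrite !inE; first by rewrite raddf0 rpred0.
move=> Nx Ny; have -> : val (a *: x + y) = a *: val x + val y by [].
by rewrite rpredD // rpredZ.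
Qed.

(* [N' :&: N] as a submodule of [N]; only used when [N'] is included in [N]. *)
Definition restrict (N N' : submodule M) : submodule (submod_sort N) :=
  Submodule (restrict_closed N N').

End Submodules.

Definition simple_module (D : nzRingType) (M : lmodType D) : Prop :=
  (exists x : M, x != 0) /\
  forall N : submodule M, (forall x, x \in N -> x = 0) \/ (forall x, x \in N).

Definition composition_series (D : nzRingType) (M : lmodType D) (k : nat)
    (N : nat -> submodule M) : Prop :=
  [/\ forall x, x \in N 0%N,
      forall x, x \in N k -> x = 0,
      forall i, (i < k)%N -> {subset N i.+1 <= N i} &
      forall i, (i < k)%N -> simple_module (quotmod (restrict (N i) (N i.+1)))].

Definition has_length (D : nzRingType) (M : lmodType D) (k : nat) : Prop :=
  exists N : nat -> submodule M, composition_series k N.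

(* A differential operator is kept in normal form: the polynomial
   [\sum_m p_m *: 'X_[m]] with coefficients [p_m : {mpoly K[n]}] stands for
   [\sum_m p_m d^m].  [weyl_act phi d] is the action of normal forms on [A] when
   the [p_m] act by multiplication by [phi p_m] and the [d_i] by [d i]. *)
Section WeylAction.
Variables (R : comNzRingType) (n : nat) (A : comNzRingType).
Variables (phi : {rmorphism {mpoly R[n]} -> A}) (d : 'I_n -> A -> A).

Definition iterd (m : 'X_{1..n}) (a : A) : A :=
  foldr (fun i => iter (m i) (d i)) a (enum 'I_n).

Definition weyl_act (P : {mpoly {mpoly R[n]}[n]}) (a : A) : A :=
  \sum_(m <- msupp P) phi P@_m * iterd m a.

End WeylAction.

Section WeylRing.
Variables (R : comNzRingType) (n : nat).
Local Notation W := {mpoly {mpoly R[n]}[n]}.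

(* left multiplication by d_i: [d_i (p d^m) = p^`M(i) d^m + p d_i d^m] *)
Definition weyl_partial (i : 'I_n) (Q : W) : W := map_mpoly (mderiv i) Q + 'X_i * Q.

Definition weyl_mul : W -> W -> W := weyl_act (@mpolyC n {mpoly R[n]}) weyl_partial.

End WeylRing.

Section WeylActionTheory.
Variables (R : comNzRingType) (n : nat).
Local Notation W := {mpoly {mpoly R[n]}[n]}.

Lemma map_mderivZX i (c : {mpoly R[n]}) (m : 'X_{1..n}) :
  map_mpoly (mderiv i) (c *: 'X_[m] : W) = c^`M(i) *: 'X_[m].
Proof.
apply/mpolyP=> k; rewrite mcoeff_map_mpoly !mcoeffZ !mcoeffX.
by case: (m == k); rewrite /= ?mulr1 ?mulr0 ?mderiv0.
Qed.

Lemma weyl_partialZX i (c : {mpoly R[n]}) m :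
  weyl_partial i (c *: 'X_[m]) = c^`M(i) *: 'X_[m] + c *: 'X_[m + U_(i)].
Proof. by rewrite /weyl_partial map_mderivZX -scalerAr -mpolyXD addmC. Qed.

Lemma weyl_partialD i : {morph @weyl_partial R n i : P Q / P + Q}.
Proof. by move=> P Q; rewrite /weyl_partial raddfD mulrDr addrACA. Qed.

Lemma weyl_partial0 i : @weyl_partial R n i 0 = 0.
Proof. by rewrite /weyl_partial raddf0 mulr0 addr0. Qed.

Lemma weyl_ind (P : W -> Prop) :
  P 0 -> (forall c m, P (c *: 'X_[m])) -> (forall p q, P p -> P q -> P (p + q)) ->
  forall Q, P Q.
Proof.
move=> P0 PX PD; elim/mpolyind => // c m p _ _ Pp; exact: PD.
Qed.

Lemma weyl_partialC i j P :
  @weyl_partial R n i (weyl_partial j P) = weyl_partial j (weyl_partial i P).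
Proof.
elim/weyl_ind: P => [|c m|p q IHp IHq]; first by rewrite !weyl_partial0.
  rewrite !weyl_partialZX [LHS]weyl_partialD [RHS]weyl_partialD !weyl_partialZX.
  by rewrite [LHS]addrACA mderiv_comm -!addmA (addmC U_(i)%MM).
by rewrite ![weyl_partial _ (p + q)]weyl_partialD [LHS]weyl_partialD [RHS]weyl_partialD IHp IHq.
Qed.

Lemma weyl_partialM i (q : {mpoly R[n]}) (P : W) :
  weyl_partial i (q%:MP * P) = (q^`M(i))%:MP * P + q%:MP * weyl_partial i P.
Proof.
elim/weyl_ind: P => [|c m|p p' IHp IHp'].
- by rewrite !mulr0 weyl_partial0 mulr0 addr0.
- rewrite !mul_mpolyC !scalerA !weyl_partialZX mderivM scalerDl.
  by rewrite scalerDr !scalerA addrA.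
- rewrite mulrDr [LHS]weyl_partialD [weyl_partial _ (p + p')]weyl_partialD.
  by rewrite IHp IHp' !mulrDr addrACA.
Qed.

Section Act.
Variables (A : comNzRingType) (phi : {rmorphism {mpoly R[n]} -> A}).
Variable d : 'I_n -> A -> A.
Hypothesis dD : forall i, {morph d i : x y / x + y}.
Hypothesis dC : forall i j a, d i (d j a) = d j (d i a).
Hypothesis dM : forall i q a, d i (phi q * a) = phi q^`M(i) * a + phi q * d i a.
Local Notation act := (weyl_act phi d).

Lemma iterdD m : {morph iterd d m : x y / x + y}.
Proof.
move=> x y; rewrite /iterd; elim: (enum _) => //= i s ->.
by elim: (m i) => //= k ->; rewrite dD.
Qed.

Lemma iterd0m a : iterd d 0%MM a = a.
Proof. by rewrite /iterd; elim: (enum _) => //= i s ->; rewrite mnm0E. Qed.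

Lemma iterd_addU i m a : iterd d (m + U_(i))%MM a = d i (iterd d m a).
Proof.
have iterC j k x : iter k (d j) (d i x) = d i (iter k (d j) x).
  by elim: k => //= k ->; rewrite dC.
have notin (s : seq 'I_n) : i \notin s ->
    foldr (fun j => iter ((m + U_(i))%MM j) (d j)) a s =
    foldr (fun j => iter (m j) (d j)) a s.
  elim: s => //= j s IH; rewrite inE negb_or => /andP[ij /IH->].
  by rewrite mnmDE mnm1E (negPf ij) addn0.
rewrite /iterd; move: (mem_enum 'I_n i) (enum_uniq 'I_n); rewrite inE.
elim: (enum _) => //= j s IH; rewrite inE.
case: eqVneq => [<- _ /andP[/notin-> _]|ij /= si /andP[_ us]].
  by rewrite mnmDE mnm1E eqxx addn1 iterS.
by rewrite (IH si us) mnmDE mnm1E (negPf ij) addn0 iterC.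
Qed.

Lemma weyl_act_supp (s : seq 'X_{1..n}) P a : uniq s -> {subset msupp P <= s} ->
  act P a = \sum_(m <- s) phi P@_m * iterd d m a.
Proof.
move=> us sub; rewrite (bigID (mem (msupp P))) /= [X in _ + X]big1 ?addr0; last first.
  by move=> m; rewrite -mcoeff_eq0 => /eqP->; rewrite rmorph0 mul0r.
rewrite -big_filter; apply: perm_big; apply: uniq_perm.
- exact: msupp_uniq.
- exact: filter_uniq.
by move=> m; rewrite mem_filter /=; case: (boolP (m \in msupp P)) => // /sub->.
Qed.

Lemma weyl_actDl a : {morph act^~ a : P Q / P + Q}.
Proof.
move=> P Q /=; pose s := undup (msupp P ++ msupp Q).
have us : uniq s by exact: undup_uniq.
rewrite (@weyl_act_supp s P) // ?(@weyl_act_supp s Q) // ?(@weyl_act_supp s (P + Q)) //.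
- by rewrite -big_split; apply: eq_bigr => m _; rewrite mcoeffD rmorphD mulrDl.
- by move=> m /msuppD_le; rewrite mem_undup.
- by move=> m; rewrite mem_undup mem_cat => ->; rewrite orbT.
- by move=> m; rewrite mem_undup mem_cat => ->.
Qed.

Lemma weyl_act0l a : act 0 a = 0.
Proof. by rewrite /weyl_act msupp0 big_nil. Qed.

Lemma weyl_actDr P : {morph act P : x y / x + y}.
Proof.
by move=> x y; rewrite -big_split; apply: eq_bigr => m _; rewrite iterdD mulrDr.
Qed.

Lemma weyl_act_sum I (r : seq I) (F : I -> W) a :
  act (\sum_(i <- r) F i) a = \sum_(i <- r) act (F i) a.
Proof.
elim: r => [|i r IH]; first by rewrite !big_nil weyl_act0l.
by rewrite !big_cons weyl_actDl IH.
Qed.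

Lemma weyl_actZX c m a : act (c *: 'X_[m]) a = phi c * iterd d m a.
Proof.
rewrite (@weyl_act_supp [:: m]) //; last by move=> k /msuppZ_le; rewrite msuppX.
by rewrite big_seq1 mcoeffZ mcoeffX eqxx mulr1.
Qed.

Lemma weyl_act1 a : act 1 a = a.
Proof.
have -> : (1 : W) = 1 *: 'X_[0%MM] by rewrite scale1r mpolyX0.
by rewrite weyl_actZX rmorph1 mul1r iterd0m.
Qed.

Lemma weyl_actC q a : act q%:MP a = phi q * a.
Proof. by rewrite -[q%:MP]mulr1 mul_mpolyC -mpolyX0 weyl_actZX iterd0m. Qed.

Lemma weyl_actX i a : act 'X_i a = d i a.
Proof.
by rewrite -['X_i]scale1r weyl_actZX rmorph1 mul1r -[U_(i)%MM]add0m iterd_addU iterd0m.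
Qed.

Lemma weyl_actCM q P a : act (q%:MP * P) a = phi q * act P a.
Proof.
elim/weyl_ind: P => [|c m|p p' IHp IHp'].
- by rewrite mulr0 weyl_act0l mulr0.
- by rewrite mul_mpolyC scalerA !weyl_actZX rmorphM mulrA.
- by rewrite mulrDr !weyl_actDl IHp IHp' mulrDr.
Qed.

Lemma weyl_act_partial i P a : act (weyl_partial i P) a = d i (act P a).
Proof.
have d0 : d i 0 = 0 by apply: (addIr (d i 0)); rewrite -dD !add0r.
elim/weyl_ind: P => [|c m|p p' IHp IHp'].
- by rewrite weyl_partial0 weyl_act0l d0.
- by rewrite weyl_partialZX weyl_actDl !weyl_actZX dM iterd_addU.
- by rewrite weyl_partialD weyl_actDl IHp IHp' -dD -weyl_actDl.
Qed.

Lemma weyl_act_iterd m P a :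
  act (iterd (@weyl_partial R n) m P) a = iterd d m (act P a).
Proof.
rewrite /iterd; elim: (enum _) => //= i s IH.
by elim: (m i) => //= k IHk; rewrite weyl_act_partial IHk.
Qed.

Lemma weyl_actM P Q a : act (weyl_mul P Q) a = act P (act Q a).
Proof.
rewrite /weyl_mul [weyl_act _ _ P Q]/weyl_act weyl_act_sum.
by apply: eq_bigr => m _; rewrite weyl_actCM weyl_act_iterd.
Qed.

End Act.

Lemma weyl_mulA : associative (@weyl_mul R n).
Proof.
move=> P Q S; symmetry.
exact: (weyl_actM weyl_partialD weyl_partialC weyl_partialM).
Qed.

Lemma weyl_mul1l : left_id 1 (@weyl_mul R n).
Proof. by move=> P; rewrite /weyl_mul weyl_act1. Qed.

Lemma iterd_weyl1 m : iterd (@weyl_partial R n) m 1 = 'X_[m].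
Proof.
have partialX i k : @weyl_partial R n i 'X_[k] = 'X_[k + U_(i)].
  by rewrite -['X_[k]]scale1r weyl_partialZX -mpolyC1 mderivC scale0r add0r scale1r.
rewrite [RHS](_ : _ = 'X_[\sum_(i <- enum 'I_n) U_(i) *+ m i]); last first.
  by congr 'X_[_]; rewrite big_enum; exact: multinomUE_id.
rewrite /iterd; elim: (enum _) => [|i s IH] /=; first by rewrite big_nil mpolyX0.
rewrite big_cons IH; elim: (m i) => [|k IHk]; first by rewrite mulm0n add0m.
by rewrite iterS IHk partialX mulmS addmC addmA.
Qed.

Lemma weyl_mul1r : right_id 1 (@weyl_mul R n).
Proof.
move=> P; rewrite {2}[P]mpolyE /weyl_mul /weyl_act.
by apply: eq_bigr => m _; rewrite iterd_weyl1 mul_mpolyC.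
Qed.

Lemma weyl_mulDl : left_distributive (@weyl_mul R n) +%R.
Proof. by move=> P Q S; rewrite /weyl_mul weyl_actDl. Qed.

Lemma weyl_mulDr : right_distributive (@weyl_mul R n) +%R.
Proof. by move=> P Q S; rewrite /weyl_mul weyl_actDr //; exact: weyl_partialD. Qed.

End WeylActionTheory.

Definition weyl (K : fieldType) (n : nat) : Type := {mpoly {mpoly K[n]}[n]}.

Section WeylAlgebra.
Variables (K : fieldType) (n : nat).

HB.instance Definition _ := GRing.Zmodule.on (weyl K n).
HB.instance Definition _ := GRing.Zmodule_isNzRing.Build (weyl K n)
  (@weyl_mulA K n) (@weyl_mul1l K n) (@weyl_mul1r K n)
  (@weyl_mulDl K n) (@weyl_mulDr K n) (oner_neq0 {mpoly {mpoly K[n]}[n]}).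

Definition weyl_coef (p : {mpoly K[n]}) : weyl K n := p%:MP.
Definition weyl_d (i : 'I_n) : weyl K n := 'X_i.

Lemma weyl_mulE (P Q : weyl K n) : P * Q = weyl_mul P Q.
Proof. by []. Qed.

Lemma weyl_coefM p q : weyl_coef (p * q) = weyl_coef p * weyl_coef q.
Proof. by rewrite weyl_mulE /weyl_mul weyl_actC /weyl_coef mpolyCM. Qed.

Lemma weyl_mul_dE i (P : weyl K n) : weyl_d i * P = weyl_partial i P.
Proof. exact: (weyl_actX _ (@weyl_partialC K n) i P). Qed.

Lemma weyl_comm i p :
  weyl_d i * weyl_coef p = weyl_coef p * weyl_d i + weyl_coef p^`M(i).
Proof.
rewrite weyl_mul_dE weyl_mulE /weyl_mul weyl_actC /weyl_coef /weyl_d.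
rewrite -[p%:MP in LHS]mulr1 mul_mpolyC -mpolyX0 weyl_partialZX add0m mul_mpolyC.
by rewrite [LHS]addrC -[_ *: 'X_[0]]mul_mpolyC mpolyX0 mulr1.
Qed.

Lemma weyl_dC i j : weyl_d i * weyl_d j = weyl_d j * weyl_d i.
Proof.
rewrite !weyl_mul_dE /weyl_d -['X_i in RHS]scale1r -['X_j in LHS]scale1r.
by rewrite !weyl_partialZX -mpolyC1 !mderivC !scale0r !add0r addmC.
Qed.

End WeylAlgebra.

Arguments weyl_d {K n} i.

Section FractionDerivation.
Variables (R : idomainType) (D : R -> R).
Hypothesis DD : {morph D : p q / p + q}.
Hypothesis DM : forall p q, D (p * q) = D p * q + p * D q.
Local Notation "p %:F" := (@FracField.tofrac R p).

(* the quotient rule, applied to a representative *)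
Definition frac_deriv (x : {fraction R}) : {fraction R} :=
  let r := repr x in
  (D \n_r * \d_r - \n_r * D \d_r)%:F / (\d_r ^+ 2)%:F.

Lemma frac_reprE (x : {fraction R}) : x = (\n_(repr x))%:F / (\d_(repr x))%:F.
Proof.
have d0 : (\d_(repr x))%:F != 0 by rewrite tofrac_eq0 denom_ratioP.
apply: (canRL (mulfK d0)); rewrite -[in LHS](reprK x).
rewrite /GRing.mul /= /FracField.tofrac; unlock; rewrite !piE /=.
apply/eqP; rewrite FracField.equivf_def /FracField.mulf.
by rewrite !numden_Ratio ?mulr1 ?oner_neq0 ?denom_ratioP // reprK mulrC.
Qed.

Lemma frac_derivE p q : q != 0 ->
  frac_deriv (p%:F / q%:F) = (D p * q - p * D q)%:F / (q ^+ 2)%:F.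
Proof.
move=> q0; rewrite /frac_deriv.
have := frac_reprE (p%:F / q%:F); have := denom_ratioP (repr (p%:F / q%:F)).
move: (\n_ _) (\d_ _) => n d d0 /eqP.
rewrite eqr_div ?tofrac_eq0 // -!tofracM tofrac_eq => /eqP E.
have := congr1 D E; rewrite !DM => E'.
have sub0 (x y : R) : x = y -> x - y = 0 by move->; rewrite subrr.
apply/eqP; rewrite eqr_div ?tofrac_eq0 ?expf_neq0 // -!tofracM tofrac_eq -subr_eq0.
have -> : (D n * d - n * D d) * q ^+ 2 - (D p * q - p * D q) * d ^+ 2 =
  q * D d * (p * d - n * q) + d * D q * (p * d - n * q) -
  q * d * (D p * d + p * D d - (D n * q + n * D q)) by ring.
by rewrite (sub0 _ _ E) (sub0 _ _ E') !mulr0 addr0 subrr.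
Qed.

Lemma frac_deriv_tofrac p : frac_deriv p%:F = (D p)%:F.
Proof.
have D1 : D 1 = 0.
  by have /esym := DM 1 1; rewrite !(mulr1, mul1r) => /(canRL (addrK _)) ->; rewrite subrr.
rewrite -[p%:F]divr1 -tofrac1 frac_derivE ?oner_neq0 //.
by rewrite D1 mulr1 mulr0 subr0 expr1n tofrac1 divr1.
Qed.

Lemma fracW (P : {fraction R} -> Prop) :
  (forall p q, q != 0 -> P (p%:F / q%:F)) -> forall x, P x.
Proof. by move=> H x; rewrite [x]frac_reprE; apply: H; exact: denom_ratioP. Qed.

Lemma frac_derivD : {morph frac_deriv : x y / x + y}.
Proof.
elim/fracW => p q q0; elim/fracW => r s s0.
rewrite addf_div ?tofrac_eq0 // -!tofracM -tofracD.
rewrite !frac_derivE ?mulf_neq0 // addf_div ?tofrac_eq0 ?expf_neq0 //.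
rewrite -!tofracM -tofracD; apply/eqP.
rewrite eqr_div ?tofrac_eq0 ?mulf_neq0 ?expf_neq0 ?mulf_neq0 // -!tofracM tofrac_eq.
by apply/eqP; rewrite DD !DM; ring.
Qed.

Lemma frac_derivM x y : frac_deriv (x * y) = frac_deriv x * y + x * frac_deriv y.
Proof.
elim/fracW: x => p q q0; elim/fracW: y => r s s0.
rewrite mulf_div -!tofracM !frac_derivE ?mulf_neq0 // !mulf_div -!tofracM.
rewrite addf_div ?tofrac_eq0 ?mulf_neq0 ?expf_neq0 // -!tofracM -tofracD; apply/eqP.
rewrite eqr_div ?tofrac_eq0 ?mulf_neq0 ?expf_neq0 ?mulf_neq0 // -!tofracM tofrac_eq.
by apply/eqP; rewrite !DM; ring.
Qed.

End FractionDerivation.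

Section Localization.
Variables (K : fieldType) (n : nat) (f : {mpoly K[n]}).
Local Notation R := {mpoly K[n]}.
Local Notation "p %:F" := (@FracField.tofrac {mpoly K[n]} p).

Definition frac_partial (i : 'I_n) : {fraction R} -> {fraction R} :=
  frac_deriv (mderiv i).

Lemma frac_partialD i : {morph frac_partial i : x y / x + y}.
Proof. exact: (frac_derivD (mderivD i) (mderivM i)). Qed.

Lemma frac_partialM i x y :
  frac_partial i (x * y) = frac_partial i x * y + x * frac_partial i y.
Proof. exact: (frac_derivM (mderivM i)). Qed.

Lemma frac_partial_tofrac i p : frac_partial i p%:F = p^`M(i)%:F.
Proof. exact: (frac_deriv_tofrac (mderivM i)). Qed.

Lemma frac_partialMl i p x :
  frac_partial i (p%:F * x) = p^`M(i)%:F * x + p%:F * frac_partial i x.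
Proof. by rewrite frac_partialM frac_partial_tofrac. Qed.

Lemma frac_partialC i j x :
  frac_partial i (frac_partial j x) = frac_partial j (frac_partial i x).
Proof.
elim/fracW: x => p q q0; set x := _ / _.
have q0F : q%:F != 0 by rewrite tofrac_eq0.
have xq : q%:F * x = p%:F by rewrite mulrC mulfVK.
have E k l : frac_partial k (frac_partial l p%:F) =
    (q^`M(l))^`M(k)%:F * x + q^`M(l)%:F * frac_partial k x +
    (q^`M(k)%:F * frac_partial l x + q%:F * frac_partial k (frac_partial l x)).
  by rewrite -xq frac_partialMl frac_partialD !frac_partialMl.
have := E i j; rewrite !frac_partial_tofrac mderiv_comm -!frac_partial_tofrac E.
rewrite !frac_partial_tofrac mderiv_comm -!addrA => /addrI; rewrite addrCA => /addrI.
by move=> /addrI /(mulfI q0F).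
Qed.

Definition frac_act : weyl K n -> {fraction R} -> {fraction R} :=
  weyl_act (@FracField.tofrac R) frac_partial.

(* [R[f^-1]] inside the field of fractions of [R] *)
Definition in_loc : {pred {fraction R}} :=
  [pred x | `[< exists p k, x = p%:F / f%:F ^+ k >]].

Lemma in_locP x : reflect (exists p k, x = p%:F / f%:F ^+ k) (x \in in_loc).
Proof. exact: asboolP. Qed.

Lemma in_loc_tofrac p : p%:F \in in_loc.
Proof. by apply/in_locP; exists p, 0%N; rewrite expr0 divr1. Qed.

Lemma in_locM_tofrac p x : x \in in_loc -> p%:F * x \in in_loc.
Proof.
by case/in_locP=> q [k ->]; apply/in_locP; exists (p * q), k; rewrite tofracM mulrA.
Qed.

Lemma in_loc0 : f = 0 -> forall x, x \in in_loc -> exists p, x = p%:F.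
Proof.
move=> f0 x /in_locP[p [[|k] ->]]; first by exists p; rewrite expr0 divr1.
by exists 0; rewrite f0 tofrac0 expr0n /= invr0 mulr0.
Qed.

Lemma in_locD : {in in_loc &, forall x y, x + y \in in_loc}.
Proof.
move=> x y xl yl; case: (eqVneq f 0) => [f0|f0].
  case: (in_loc0 f0 xl) (in_loc0 f0 yl) => p -> [q ->].
  by rewrite -tofracD in_loc_tofrac.
case/in_locP: xl => p [k ->]; case/in_locP: yl => q [l ->].
apply/in_locP; exists (p * f ^+ l + q * f ^+ k), (k + l)%N.
have fX m : f%:F ^+ m != 0 by rewrite expf_neq0 // tofrac_eq0.
by rewrite addf_div // tofracD !tofracM !tofracXn exprD.
Qed.

Lemma in_locN : {in in_loc, forall x, - x \in in_loc}.
Proof. by move=> x xl; rewrite -mulN1r -tofrac1 -tofracN in_locM_tofrac. Qed.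

Lemma in_loc_closed : zmod_closed in_loc.
Proof.
split=> [|x y xl yl]; first by rewrite -tofrac0 in_loc_tofrac.
by rewrite in_locD ?in_locN.
Qed.

HB.instance Definition _ := GRing.isZmodClosed.Build {fraction R} in_loc in_loc_closed.

Lemma in_loc_partial i x : x \in in_loc -> frac_partial i x \in in_loc.
Proof.
move=> xl; case: (eqVneq f 0) => [f0|f0].
  by case: (in_loc0 f0 xl) => p ->; rewrite frac_partial_tofrac in_loc_tofrac.
case/in_locP: xl => p [k ->]; apply/in_locP.
exists (p^`M(i) * f ^+ k - p * (f ^+ k)^`M(i)), (k + k)%N.
rewrite -!tofracXn /frac_partial (frac_derivE (mderivM i)) ?expf_neq0 //.
by rewrite exprD tofracXn expr2.
Qed.

Lemma frac_act_loc P x : x \in in_loc -> frac_act P x \in in_loc.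
Proof.
move=> xl; rewrite rpred_sum // => m _; apply: in_locM_tofrac; rewrite /iterd.
by elim: (enum _) => //= i s; elim: (m i) => //= k IH /IH; apply: in_loc_partial.
Qed.

Record loc := Loc { loc_val : {fraction R}; _ : loc_val \in in_loc }.

HB.instance Definition _ := [isSub for loc_val].
HB.instance Definition _ := [Choice of loc by <:].
HB.instance Definition _ := [SubChoice_isSubZmodule of loc by <:].

Definition loc_scale (P : weyl K n) (x : loc) : loc :=
  Loc (frac_act_loc P (valP x)).

Lemma loc_scaleA P Q x : loc_scale P (loc_scale Q x) = loc_scale (P * Q) x.
Proof.
apply: val_inj; symmetry.
exact: (weyl_actM frac_partialD frac_partialC frac_partialMl).
Qed.

Lemma loc_scale1 : left_id 1 loc_scale.
Proof. move=> x; apply: val_inj; exact: weyl_act1. Qed.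

Lemma loc_scaleDr : right_distributive loc_scale +%R.
Proof. move=> P x y; apply: val_inj; exact: (weyl_actDr _ frac_partialD). Qed.

Lemma loc_scaleDl x : {morph loc_scale^~ x : P Q / P + Q}.
Proof. move=> P Q; apply: val_inj; exact: weyl_actDl. Qed.

HB.instance Definition _ := GRing.Zmodule_isLmodule.Build (weyl K n) loc
  loc_scaleA loc_scale1 loc_scaleDr loc_scaleDl.

Lemma loc_scale_coef p (x : loc) : val (weyl_coef p *: x) = p%:F * val x.
Proof. exact: weyl_actC. Qed.

Lemma loc_scale_d i (x : loc) : val (weyl_d i *: x) = frac_partial i (val x).
Proof. exact: (weyl_actX _ frac_partialC). Qed.

Definition in_poly : {pred loc} := [pred x | `[< exists p, val x = p%:F >]].

Lemma in_polyP x : reflect (exists p, val x = p%:F) (x \in in_poly).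
Proof. exact: asboolP. Qed.

Lemma in_poly_closed : GRing.submod_closed in_poly.
Proof.
split=> [|P x y]; first by apply/in_polyP; exists 0; rewrite tofrac0.
move=> /in_polyP[p px] /in_polyP[q qy]; apply/in_polyP.
suff [r Pr] : exists r, frac_act P (val x) = r%:F.
  by exists (r + q); rewrite tofracD -Pr -qy.
have it m : exists r, iterd frac_partial m (val x) = r%:F.
  rewrite /iterd; elim: (enum _) => [|i s IH] /=; first by exists p.
  elim: (m i) => //= k [r ->]; exists r^`M(i); exact: frac_partial_tofrac.
rewrite /frac_act /weyl_act; elim: (msupp P) => [|m s [r IH]].
  by exists 0; rewrite big_nil tofrac0.
by have [r' E] := it m; exists (P@_m * r' + r); rewrite big_cons IH E tofracD tofracM.
Qed.

Definition poly_sub : submodule loc := Submodule in_poly_closed.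

Definition local_cohomology1 := quotmod poly_sub.
HB.instance Definition _ := GRing.Lmodule.on local_cohomology1.

End Localization.

Section Moebius.
Variables (d : Order.disp_t) (T : finPOrderType d).
Local Open Scope order_scope.

(* recursion on fuel [k]; [#|T|] is enough since [x <= z < y] makes the number of
   elements of the half-open interval decrease, see [moebius_lt] *)
Fixpoint moebius_rec (k : nat) (x y : T) : int :=
  if x == y then 1 else
  if x < y then
    if k is k'.+1 then - \sum_(z | x <= z < y) moebius_rec k' x z else 0
  else 0.

Definition moebius (x y : T) : int := moebius_rec #|T| x y.

Lemma moebius_refl x : moebius x x = 1.
Proof. by rewrite /moebius; case: #|T| => [|k] /=; rewrite eqxx. Qed.

Lemma moebius_nle x y : ~~ (x <= y) -> moebius x y = 0.
Proof.
rewrite le_eqVlt negb_or => /andP[/negPf xy /negPf xy'].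
by rewrite /moebius; case: #|T| => [|k] /=; rewrite xy xy'.
Qed.

Lemma moebius_lt x y : x < y -> moebius x y = - \sum_(z | x <= z < y) moebius x z.
Proof.
pose h y := #|[pred z | x <= z < y]|.
have h_lt t z : x <= z < t -> (h z < h t)%N.
  move=> /andP[xz zt]; apply: proper_card; apply/properP; split.
    by apply/fintype.subsetP => u; rewrite !inE => /andP[-> /lt_trans->].
  by exists z; rewrite !inE ?xz ?zt // ltxx andbF.
have stable k l z : (h z < k)%N -> (h z < l)%N -> moebius_rec k x z = moebius_rec l x z.
  elim: k l z => // k IH [//|l] z; rewrite !ltnS => hk hl /=.
  case: eqVneq => // _; case: ifP => // xz; congr (- _); apply: eq_bigr => t xt.
  by apply: IH; apply: leq_trans (h_lt _ _ xt) _.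
have hT z : (h z < #|T|)%N.
  apply: leq_trans (max_card predT); apply: proper_card; apply/properP.
  by split; [apply/fintype.subsetP | exists z; rewrite // !inE ltxx andbF].
move=> xy; rewrite {1}/moebius; move: (hT y).
case E: #|T| => [//|k] hy /=; rewrite lt_eqF // xy; congr (- _).
apply: eq_bigr => z xz; rewrite /moebius; apply: stable; last exact: hT.
exact: leq_trans (h_lt _ _ xz) _.
Qed.

End Moebius.

Section Arrangement.
Variables (K : fieldType) (n : nat).
Local Notation V := 'rV[K]_n.

Definition zero_locus (p : {mpoly K[n]}) : set V := [set v : V | p.@[v 0] = 0]%classic.

Definition arrangement (m : nat) (l : 'I_m -> {mpoly K[n]}) : {fset set V} :=
  [fset zero_locus (l i) | i in 'I_m]%fset.

Variable A : {fset set V}.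

Definition intersections : {fset set V} :=
  [fset X in [fset (\bigcap_(H in [set` B]) H)%classic | B : {fset set V} in fpowerset A]
   | X != set0]%fset.

Lemma intersectionsP (X : set V) :
  X \in intersections <->
  (X !=set0)%classic /\
  exists2 B : {fset set V}, (B `<=` A)%fset & X = (\bigcap_(H in [set` B]) H)%classic.
Proof.
rewrite !inE; split=> [/andP[/imfsetP[B /= BA ->] /set0P X0]|[/set0P X0 [B BA XE]]].
  by split=> //; exists B => //; rewrite -fpowersetE.
by rewrite X0 andbT; apply/imfsetP; exists B; rewrite //= fpowersetE.
Qed.

Definition flat : Type := intersections.
HB.instance Definition _ := Finite.on flat.

Definition flat_set (X : flat) : set V := \val (X : intersections).
Definition flat_le (X Y : flat) : bool := `[< (flat_set Y `<=` flat_set X)%classic >].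

Lemma flat_le_refl : reflexive flat_le.
Proof. by move=> X; apply/asboolP. Qed.

Lemma flat_le_anti : antisymmetric flat_le.
Proof.
move=> X Y /andP[/asboolP YX /asboolP XY]; apply: val_inj.
exact/seteqP.
Qed.

Lemma flat_le_trans : transitive flat_le.
Proof.
move=> Y X Z /asboolP YX /asboolP ZY; apply/asboolP.
exact: subset_trans ZY YX.
Qed.

HB.instance Definition _ := Order.Le_isPOrder.Build (Order.Disp tt tt) flat
  flat_le_refl flat_le_anti flat_le_trans.

Lemma setT_intersection : setT \in intersections.
Proof.
apply/intersectionsP; split; first by exists 0.
by exists fset0; rewrite ?fsub0set // set_fset0 bigcap_set0.
Qed.

Definition flatV : flat := [` setT_intersection]%fset.

Definition mu (X : flat) : int := moebius flatV X.

(* the vector subspace of the differences of points of [X]; the default [0] is not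
   used when [X] is an affine subspace, see [directionP] *)
Definition direction (X : set V) : {vspace V} :=
  xget 0%VS [set W : {vspace V} |
    forall v, v \in W <-> exists x y, [/\ X x, X y & v = x - y]]%classic.

Lemma directionP (X : set V) : (X !=set0)%classic ->
    (forall (c : K) x y z, X x -> X y -> X z -> X (x + c *: (y - z))) ->
  forall v, v \in direction X <-> exists x y, [/\ X x, X y & v = x - y].
Proof.
move=> [o Xo] Xaff.
have diffP v : (exists x y, [/\ X x, X y & v = x - y]) <-> X (o + v).
  split=> [[x [y [Xx Xy ->]]]|Xv]; first by rewrite -[x - y]scale1r; apply: Xaff.
  by exists (o + v), o; split=> //; rewrite [o + v]addrC addrK.
have DZ (c : K) u v : X (o + u) -> X (o + v) -> X (o + (c *: u + v)).
  move=> Xu Xv; rewrite (_ : o + _ = (o + v) + c *: ((o + u) - o)); first exact: Xaff.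
  by rewrite [o + u]addrC addrK -addrA [v + _]addrC.
pose P k := `[< exists W : {vspace V}, (forall v, v \in W -> X (o + v)) /\ \dim W = k >].
have P0 : exists k, P k.
  exists 0%N; apply/asboolP; exists 0%VS; rewrite dimv0; split=> // v.
  by rewrite memv0 => /eqP ->; rewrite addr0.
have Pn k : P k -> (k <= n)%N.
  move=> /asboolP[W [_ <-]]; apply: leq_trans (dimvS (subvf W)) _.
  by rewrite dimvf /dim /= mul1n.
case: (ex_maxnP P0 Pn) => k /asboolP[W [WX dW]] maxk.
apply: (@xgetPex _ 0%VS [set W : {vspace V} | forall v, v \in W <-> _]%classic).
exists W => v; rewrite diffP; split=> [/WX //|Xv].
have /maxk : P (\dim (W + <[v]>)%VS).
  apply/asboolP; exists (W + <[v]>)%VS; split=> // u /memv_addP[w wW [z /vlineP[c ->] ->]].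
  by rewrite [w + _]addrC; apply: DZ => //; exact: WX.
rewrite -dW => dimWv; have := dimv_leqif_eq (addvSl W <[v]>).
move=> [_]; rewrite eqn_leq dimWv dimvS ?addvSl //= => /esym/eqP ->.
by rewrite memvE addvSr.
Qed.

Definition codim (X : set V) : nat := (n - \dim (direction X))%N.

Definition poincare : {poly int} :=
  \sum_(X : flat) mu X *: (- 'X) ^+ codim (flat_set X).

End Arrangement.

(* Main.v *)
From HB Require Import structures.
Require Import Defs.
From mathcomp Require Import all_boot all_order all_algebra finmap.
From mathcomp Require Import generic_quotient ring_quotient fraction ring.
From mathcomp Require Import mpoly.
From mathcomp Require Import boolp classical_sets.
Set Implicit Arguments.
Unset Strict Implicit.
Unset Printing Implicit Defensive.
Import Order.TTheory GRing.Theory Num.Theory.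
Local Open Scope ring_scope.
Local Open Scope quotient_scope.

Local Notation "p %:F" := (@FracField.tofrac _ p).

(** All modules in sight are subquotients of the field of fractions [F] of [R].
For a set [S] of indices let [R_S] be the localization of [R] at the product
of the [l i], [i] in [S].  For a set [C] whose forms are independent and a
disjoint set [G] put

  [Q C G = R_(C u G) / \sum_(i in C) R_((C \ i) u G)].

When [G] is empty this is the module of delta-functions along the affine
subspace [X_C] cut out by the forms of [C], which is simple
([covers_lower_poles]).  In general [Q C G] is the localization of that module
at the forms of [G], and its length is found by removing one form [g] from [G],
as in the deletion-restriction recursion for hyperplane arrangements.  Write
[G = g |: G'], where no form of [G] vanishes identically on [X_C].

- If [g] is not constant on [X_C], and no form of [G'] vanishes on the zeros of
  [g] in [X_C], then there is an exact sequence
  [0 -> Q C G' -> Q C G -> Q (g |: C) G' -> 0].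
- Otherwise [g] agrees on [X_C], up to a nonzero factor, with [1] or with a
  form of [G'], so that it is already invertible, and [Q C G = Q C G'].

Exactness on the left amounts to [g] being a nonzerodivisor on [Q C G']
([lower_poles_cap]); this follows from simplicity, the [g]-torsion being a
submodule.  The last equality is [localization_add_dependent].

On the combinatorial side let [signed_count C G X] be the sum of [(-1) ^ #|B|]
over the subsets [B] of [G] with [X_(C u B) = X].  It satisfies
[signed_count C G X = signed_count C G' X - signed_count (g |: C) G' X], and
the subtracted term vanishes in the second case.  Hence
[(-1) ^ (codim X + #|C|) * signed_count C G X] follows the same recursion as
the length, contributes the value 1 or 0 for empty [G], and so is a natural
number; the sum of these numbers over all flats is the length of [Q C G]
([length_delta_module]).  When [G] grows by one index at a time, from the empty set
to the set of all indices, the localizations [R_G] form a filtration from [R] to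
[R[f^-1]] with quotients [R_G / R_G' = Q {g} G'], and composition series of these
are put together.  Finally
[signed_count] for empty [C] and full [G] is the Moebius function, by Whitney's
theorem ([mu_signed_count]), which gives both equalities. *)

(** * Submodules of the field of fractions *)

Section DStable.
Variables (K : fieldType) (n : nat).
Local Notation R := {mpoly K[n]}.
Local Notation F := {fraction {mpoly K[n]}}.

(** The submodules of [F] over the Weyl algebra: closure under the action of
    an arbitrary operator is [dstable_act]. *)
Record dstable (N : set F) : Prop := DStable {
  dstable0 : N 0;
  dstableD : forall x y, N x -> N y -> N (x + y);
  dstableM : forall p x, N x -> N (p%:F * x);
  dstable_partial : forall i x, N x -> N (frac_partial i x) }.

Lemma dstable_opp N x : dstable N -> N x -> N (- x).
Proof. by move=> sN /(dstableM sN (-1)); rewrite tofracN tofrac1 mulN1r. Qed.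

Lemma dstableB N x y : dstable N -> N x -> N y -> N (x - y).
Proof. by move=> sN Nx Ny; apply: dstableD => //; apply: dstable_opp. Qed.

Lemma dstable_sum N I (r : seq I) (P : pred I) u : dstable N ->
  (forall i, P i -> N (u i)) -> N (\sum_(i <- r | P i) u i).
Proof. by move=> sN Nu; elim/big_ind: _ => //; [exact: dstable0|exact: dstableD]. Qed.

Lemma dstable_act N P x : dstable N -> N x -> N (frac_act P x).
Proof.
move=> sN Nx; apply: dstable_sum => // m _; apply: dstableM => //.
rewrite /iterd; elim: (enum _) => //= i s; elim: (m i) => //= k IH /IH.
exact: dstable_partial.
Qed.

Definition sum_set (A B : set F) : set F :=
  [set x | exists a b, [/\ A a, B b & x = a + b]]%classic.

Lemma dstable_sum_set A B : dstable A -> dstable B -> dstable (sum_set A B).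
Proof.
move=> sA sB; split.
- by exists 0, 0; rewrite addr0; split=> //; exact: dstable0.
- move=> _ _ [a [b [Aa Bb ->]]] [a' [b' [Aa' Bb' ->]]].
  by exists (a + a'), (b + b'); rewrite addrACA; split=> //; exact: dstableD.
- move=> p _ [a [b [Aa Bb ->]]]; exists (p%:F * a), (p%:F * b).
  by rewrite mulrDr; split=> //; exact: dstableM.
- move=> i _ [a [b [Aa Bb ->]]]; exists (frac_partial i a), (frac_partial i b).
  by rewrite frac_partialD; split=> //; exact: dstable_partial.
Qed.

Lemma dstableI A B : dstable A -> dstable B -> dstable (A `&` B)%classic.
Proof.
move=> sA sB; split.
- by split; exact: dstable0.
- by move=> x y [Ax Bx] [Ay By]; split; exact: dstableD.
- by move=> p x [Ax Bx]; split; exact: dstableM.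
- by move=> i x [Ax Bx]; split; exact: dstable_partial.
Qed.

(** [Q / P] is a simple module. *)
Record covers (P Q : set F) : Prop := Cover {
  cover_bot : dstable P;
  cover_top : dstable Q;
  cover_sub : (P `<=` Q)%classic;
  cover_neq : P <> Q;
  cover_simple : forall N, dstable N -> (P `<=` N)%classic -> (N `<=` Q)%classic ->
    N = P \/ N = Q }.

(** [M / N] has a composition series with [k] factors.  Length is handled through
    explicit series, which are concatenated and transported. *)
Inductive chain (N : set F) : set F -> nat -> Prop :=
| chain_nil : dstable N -> chain N N 0
| chain_cons P Q k : chain N P k -> covers P Q -> chain N Q k.+1.

Lemma chain_cat N P Q j k : chain N P j -> chain P Q k -> chain N Q (j + k).
Proof.
move=> NP; elim=> [_|P' Q' k' _ IH c]; first by rewrite addn0.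
by rewrite addnS; apply: chain_cons IH c.
Qed.

Lemma chain_sub N M k : chain N M k -> (N `<=` M)%classic.
Proof.
elim=> [_ //|P Q k' _ IH c]; exact: subset_trans IH (cover_sub c).
Qed.

(** Both submodules are recovered from their sums with [B] by the modular law:
    [(P + B) /\ Q = P + (B /\ Q) = P], because [B /\ Q] is contained in [P]. *)
Lemma cover_sum_set A B P Q : dstable A -> dstable B ->
  (A `&` B `<=` P)%classic -> covers P Q -> (Q `<=` A)%classic ->
  covers (sum_set P B) (sum_set Q B).
Proof.
move=> sA sB ABP c QA; have sP := cover_bot c; have sQ := cover_top c.
have PQ := cover_sub c.
have QPB x : Q x -> sum_set P B x -> P x.
  move=> Qx [a [b [Pa Bb E]]]; rewrite E; apply: dstableD => //; apply: ABP.
  split=> //; rewrite (_ : b = x - a); last by rewrite E addrC addKr.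
  by apply: dstableB => //; [exact: QA|exact: QA (PQ _ Pa)].
have subQ x : Q x -> sum_set Q B x.
  by move=> Qx; exists x, 0; rewrite addr0; split=> //; exact: dstable0.
split; [exact: dstable_sum_set|exact: dstable_sum_set| | |].
- by move=> _ [a [b [Pa Bb ->]]]; exists a, b; split=> //; exact: PQ.
- move=> E; apply: (cover_neq c); apply/seteqP; split=> // x Qx.
  by apply: QPB => //; rewrite E; exact: subQ.
move=> N sN PN NQ.
have BN x : B x -> N x.
  by move=> Bx; apply: PN; exists 0, x; rewrite add0r; split=> //; exact: dstable0.
have PN' x : P x -> N x.
  by move=> Px; apply: PN; exists x, 0; rewrite addr0; split=> //; exact: dstable0.
have NE x : N x -> exists a b, [/\ (N `&` Q)%classic a, B b & x = a + b].
  move=> Nx; case: (NQ x Nx) => a [b [Qa Bb E]]; exists a, b; split=> //; split=> //.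
  rewrite (_ : a = x - b); last by rewrite E addrK.
  by apply: dstableB => //; exact: BN.
have PNQ : (P `<=` N `&` Q)%classic by move=> x Px; split; [exact: PN'|exact: PQ].
case: (cover_simple c (dstableI sN sQ) PNQ (@subIsetr _ N Q)) => E; [left|right].
  apply/seteqP; split=> // x /NE[a [b [NQa Bb ->]]].
  by exists a, b; split=> //; rewrite -E.
apply/seteqP; split=> // _ [a [b [Qa Bb ->]]]; apply: dstableD => //; last exact: BN.
by move: Qa; rewrite -E => -[].
Qed.

Lemma sum_setIl A B : dstable A -> dstable B -> sum_set (A `&` B)%classic B = B.
Proof.
move=> sA sB; apply/seteqP; split=> [_ [a [b [[_ Ba] Bb ->]]]|x Bx].
  exact: dstableD.
by exists 0, x; rewrite add0r; split=> //; split; exact: dstable0.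
Qed.

(** The second isomorphism theorem [A / (A /\ B) = (A + B) / B], on the level of
    composition series. *)
Lemma chain_sum_set A B k : dstable A -> dstable B ->
  chain (A `&` B)%classic A k -> chain B (sum_set A B) k.
Proof.
move=> sA sB; have H M j : chain (A `&` B)%classic M j -> (M `<=` A)%classic ->
    chain B (sum_set M B) j.
  elim=> [_ _|P Q j' NP IH c QA].
    by rewrite sum_setIl //; exact: chain_nil.
  have PA := subset_trans (cover_sub c) QA.
  apply: chain_cons (IH PA) _; exact: cover_sum_set (chain_sub NP) c QA.
by move=> /H; apply.
Qed.

(** The series is listed from the top down, and constant from index [k] on, so
    that all its terms are submodules. *)
Lemma chain_steps N M k : chain N M k -> exists S : nat -> set F,
  [/\ S 0%N = M, S k = N, forall i, dstable (S i) &
      forall i, (i < k)%N -> covers (S i.+1) (S i)].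
Proof.
elim=> [sN|P Q k' _ [S [S0 Sk sS cS]] c]; first by exists (fun=> N); split.
exists (fun i => if i is j.+1 then S j else Q); split=> //.
- by case=> [|i]; [exact: cover_top c|exact: sS].
- by case=> [_|i ik]; [rewrite S0|exact: cS].
Qed.

End DStable.

(** * Composition series of local cohomology *)

Section Transfer.
Variables (K : fieldType) (n : nat) (f : {mpoly K[n]}).
Local Notation F := {fraction {mpoly K[n]}}.
Local Notation H1 := (local_cohomology1 f).
Local Notation pi := (\pi_(Quotient.quot (carrier (poly_sub f)))).

Definition poly_set : set F := [set x | exists p : {mpoly K[n]}, x = p%:F]%classic.
Definition loc_set : set F := [set x | x \in in_loc f]%classic.

(** [S / R], as a submodule of [R[f^-1] / R] when [R <= S <= R[f^-1]] *)
Definition image_pred (S : set F) : {pred H1} :=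
  [pred x | `[< exists y : loc f, x = pi y /\ S (val y) >]].

Lemma image_pred_closed S : dstable S -> GRing.submod_closed (image_pred S).
Proof.
move=> sS; split.
  by apply/asboolP; exists 0; split; [rewrite raddf0|exact: dstable0].
move=> P _ _ /asboolP[x [-> Sx]] /asboolP[y [-> Sy]]; apply/asboolP.
exists (P *: x + y); split; last first.
  by apply: dstableD => //; exact: dstable_act.
rewrite raddfD; congr (_ + _); exact: qmscale_pi.
Qed.

Definition image_sub S (sS : dstable S) : submodule H1 :=
  Submodule (image_pred_closed sS).

Lemma mem_image_sub S (sS : dstable S) y : (poly_set `<=` S)%classic ->
  (pi y \in image_sub sS) <-> S (val y).
Proof.
move=> RS; split=> [/asboolP[z [E Sz]]|Sy]; last by apply/asboolP; exists y.
have : y - z \in poly_sub f by rewrite Quotient.idealrBE E.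
case/asboolP => p yz; have -> : val y = val (y - z) + val z by rewrite /= subrK.
by apply: dstableD => //; apply: RS; exists p.
Qed.

(** A submodule [U] of [(Q / R) / (P / R)] is pulled back to the submodule [S'] of
    [F] of all elements of [Q] with class in [U]. *)
Lemma simple_quotient P Q (sP : dstable P) (sQ : dstable Q) :
  (poly_set `<=` P)%classic -> (Q `<=` loc_set)%classic -> covers P Q ->
  simple_module (quotmod (restrict (image_sub sQ) (image_sub sP))).
Proof.
move=> RP QL c; have PQ := cover_sub c.
have RQ := subset_trans RP PQ.
set X := restrict _ _.
pose pi' : submod_sort (image_sub sQ) -> quotmod X := \pi_(Quotient.quot (carrier X)).
have pi'0 e : (pi' e == 0) = (e \in X).
  by rewrite -[e in RHS]subr0 Quotient.idealrBE raddf0.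
have liftQ z : Q z -> exists (y : loc f) (e : submod_sort (image_sub sQ)),
    val y = z /\ val e = pi y.
  move=> Qz; pose y := Loc (QL _ Qz : z \in in_loc f).
  have Qy : pi y \in image_sub sQ by apply/mem_image_sub.
  by exists y, (SubElt Qy).
split.
  have [z [Qz Pz]] : exists z, Q z /\ ~ P z.
    apply: contrapT => H; apply: (cover_neq c); apply/seteqP; split=> // z Qz.
    by apply: contrapT => Pz; apply: H; exists z.
  have [y [e [yz ey]]] := liftQ z Qz; exists (pi' e); rewrite pi'0.
  apply/negP => /= eX; apply: Pz; rewrite -yz.
  apply/(mem_image_sub sP _ RP); rewrite -ey; exact: eX.
move=> U.
pose S' : set F := [set z | exists (y : loc f) (e : submod_sort (image_sub sQ)),
  [/\ val y = z, val e = pi y & pi' e \in U]]%classic.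
have sS' : dstable S'.
  have act W z : S' z -> S' (frac_act W z).
    move=> [y [e [<- ey Ue]]]; exists (W *: y), (W *: e); split=> //.
      by rewrite /= ey; exact: qmscale_pi.
    rewrite (_ : pi' (W *: e) = W *: pi' e) ?rpredZ //.
    by apply: esym; exact: (@qmscale_pi _ _ X W e).
  split.
  - exists 0, 0; split=> //; first by rewrite !raddf0.
    by rewrite /pi' raddf0 rpred0.
  - move=> _ _ [y [e [<- ey Ue]]] [y' [e' [<- ey' Ue']]].
    exists (y + y'), (e + e'); split=> //; first by rewrite /= ey ey' -raddfD.
    by rewrite /pi' raddfD rpredD.
  - by move=> p x /(act (weyl_coef p)); rewrite /frac_act weyl_actC.
  - move=> i x /(act (weyl_d i)); rewrite /frac_act weyl_actX //.
    exact: frac_partialC.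
have PS' : (P `<=` S')%classic.
  move=> z Pz; have [y [e [yz ey]]] := liftQ z (PQ _ Pz); exists y, e; split=> //.
  suff /eqP -> : pi' e == 0 by rewrite rpred0.
  rewrite pi'0; suff : val e \in image_sub sP by [].
  by rewrite ey; apply/(mem_image_sub sP _ RP); rewrite yz.
have S'Q : (S' `<=` Q)%classic.
  move=> z [y [e [<- ey _]]]; apply/(mem_image_sub sQ _ RQ); rewrite -ey; exact: valP.
have [E|E] := cover_simple c sS' PS' S'Q; [left|right]; apply: quotmodW => e.
  move=> Ue; have /asboolP[y [ey Qy]] := valP e.
  have : S' (val y) by exists y, e.
  rewrite E => Py; apply/eqP; rewrite pi'0.
  suff : val e \in image_sub sP by [].
  by rewrite ey; apply/(mem_image_sub sP _ RP).
have /asboolP[y [ey Qy]] := valP e.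
have : S' (val y) by rewrite E.
move=> [y' [e' [yy' ey' Ue']]]; suff -> : e = e' by [].
by apply: val_inj; rewrite ey' [LHS]ey (val_inj yy').
Qed.

Lemma has_length_local_cohomology k : chain poly_set loc_set k -> has_length H1 k.
Proof.
move=> Lk; have [S [S0 Sk sS cS]] := chain_steps Lk.
have SL i : (i <= k)%N -> (S i `<=` loc_set)%classic.
  elim: i => [_|i IH ik]; first by rewrite S0.
  exact: subset_trans (cover_sub (cS _ ik)) (IH (ltnW ik)).
have RS i : (i <= k)%N -> (poly_set `<=` S i)%classic.
  move=> ik; rewrite -(subKn ik); move: (k - i)%N (leq_subr i k) => j.
  elim: j => [_|j IH jk]; first by rewrite subn0 Sk.
  apply: subset_trans (IH (ltnW jk)) _; rewrite -(subnSK jk).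
  by apply: cover_sub; apply: cS; rewrite ltn_subrL (leq_ltn_trans _ jk).
exists (fun i => image_sub (sS i)); split.
- apply: quotmodW => y; apply/mem_image_sub; first exact: RS.
  by rewrite S0; exact: valP.
- apply: quotmodW => y /(mem_image_sub (sS k) y (RS k (leqnn k))).
  rewrite Sk => Py; apply/eqP; rewrite -(raddf0 pi) -Quotient.idealrBE subr0.
  exact/asboolP.
- move=> i ik; apply: quotmodW => y /(mem_image_sub (sS i.+1) y (RS _ ik)) Sy.
  apply/(mem_image_sub (sS i) y (RS _ (ltnW ik))).
  exact: (cover_sub (cS _ ik)).
- move=> i ik; apply: simple_quotient; [exact: RS|by apply: SL; exact: ltnW|exact: cS].
Qed.

End Transfer.

(** * Derivations *)

Section Derivation.
Variables (A : comNzRingType) (D : A -> A).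
Hypothesis DD : {morph D : x y / x + y}.
Hypothesis DM : forall x y, D (x * y) = D x * y + x * D y.

Lemma derivation0 : D 0 = 0.
Proof. by apply: (addIr (D 0)); rewrite -DD !add0r. Qed.

Lemma derivation1 : D 1 = 0.
Proof. by apply: (addIr (D 1)); have := DM 1 1; rewrite !mulr1 mul1r add0r => <-. Qed.

Lemma derivation_exp x k : D (x ^+ k.+1) = (x ^+ k * D x) *+ k.+1.
Proof.
elim: k => [|k IH]; first by rewrite expr1 expr0 mul1r.
by rewrite exprS DM IH mulrnAr mulrA -exprS mulrC -mulrS.
Qed.

Lemma derivation_sum I (r : seq I) P u :
  D (\sum_(i <- r | P i) u i) = \sum_(i <- r | P i) D (u i).
Proof. exact: (big_morph D DD derivation0). Qed.

(** Logarithmic derivatives add up.  Stated with eigenvalues, this holds for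
    factors that are not invertible as well. *)
Lemma derivation_prod I (r : seq I) (P : pred I) u c :
  (forall i, P i -> D (u i) = c i * u i) ->
  D (\prod_(i <- r | P i) u i) = (\sum_(i <- r | P i) c i) * \prod_(i <- r | P i) u i.
Proof.
move=> uc; pose Q s v := D v = s * v.
suff : Q (\sum_(i <- r | P i) c i) (\prod_(i <- r | P i) u i) by [].
elim/big_ind2: _ => //; first by rewrite /Q mul0r derivation1.
by move=> s v s' v' E E'; rewrite /Q DM E E'; ring.
Qed.

End Derivation.

Lemma derivation_expN (A : fieldType) (D : A -> A)
    (DM : forall x y, D (x * y) = D x * y + x * D y)
    (x : A) k : x != 0 -> D (x ^- k) = - (D x / x) *+ k * x ^- k.
Proof.
move=> x0; have xk0 : x ^+ k != 0 by rewrite expf_neq0.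
have := DM (x ^+ k) (x ^- k); rewrite divff // (derivation1 DM) => /esym/eqP.
rewrite addrC addr_eq0 => /eqP E; apply: (mulfI xk0); rewrite {}E.
case: k xk0 => [|k] xk0.
  by rewrite expr0 (derivation1 DM) mulr0n !mul0r mulr0 oppr0.
rewrite (derivation_exp DM) exprS.
rewrite -[_ * _ *+ _]mulr_natr -[(- _) *+ _]mulr_natr.
have y0 : x ^+ k != 0 by rewrite expf_neq0.
by move: (x ^+ k) y0 (k.+1%:R : A) => y y0 c; field; rewrite x0 y0.
Qed.

(** * Directional derivatives and polynomials of degree one *)

Section DirectionalDerivative.
Variables (K : fieldType) (n : nat).
Local Notation R := {mpoly K[n]}.
Local Notation F := {fraction {mpoly K[n]}}.

Definition frac_const (c : K) : F := (c%:MP : R)%:F.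

HB.instance Definition _ :=
  GRing.RMorphism.copy frac_const (@FracField.tofrac R \o @mpolyC n K).

Definition dir_deriv (v : 'rV[K]_n) (x : F) : F := \sum_a frac_const (v 0 a) * frac_partial a x.

Lemma dir_derivD v : {morph dir_deriv v : x y / x + y}.
Proof.
move=> x y; rewrite /dir_deriv -big_split; apply: eq_bigr => a _.
by rewrite frac_partialD mulrDr.
Qed.

Lemma dir_derivM v x y : dir_deriv v (x * y) = dir_deriv v x * y + x * dir_deriv v y.
Proof.
rewrite /dir_deriv mulr_suml mulr_sumr -big_split; apply: eq_bigr => a _ /=.
by rewrite frac_partialM; ring.
Qed.

Lemma dir_derivDl u v x : dir_deriv (u + v) x = dir_deriv u x + dir_deriv v x.
Proof.
by rewrite -big_split; apply: eq_bigr => a _; rewrite mxE rmorphD mulrDl.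
Qed.

Lemma dir_derivZl c v x : dir_deriv (c *: v) x = frac_const c * dir_deriv v x.
Proof. by rewrite mulr_sumr; apply: eq_bigr => a _; rewrite mxE rmorphM mulrA. Qed.

Lemma dir_derivBl u v x : dir_deriv (u - v) x = dir_deriv u x - dir_deriv v x.
Proof. by rewrite dir_derivDl -scaleN1r dir_derivZl rmorphN rmorph1 mulN1r. Qed.

Lemma dir_deriv_suml I (r : seq I) (P : pred I) (u : I -> 'rV[K]_n) x :
  dir_deriv (\sum_(i <- r | P i) u i) x = \sum_(i <- r | P i) dir_deriv (u i) x.
Proof.
apply: (big_morph (dir_deriv^~ x) (fun u v => dir_derivDl u v x)).
by rewrite -[0 in LHS](scale0r 0) dir_derivZl rmorph0 mul0r.
Qed.

Lemma dir_deriv_delta a x : dir_deriv (delta_mx 0 a) x = frac_partial a x.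
Proof.
rewrite /dir_deriv (bigD1 a) //= mxE !eqxx rmorph1 mul1r big1 ?addr0 // => b ba.
by rewrite mxE (negPf ba) rmorph0 mul0r.
Qed.

Lemma dstable_dir_deriv N v x : dstable N -> N x -> N (dir_deriv v x).
Proof.
move=> sN Nx; apply: dstable_sum => // a _; apply: dstableM => //.
exact: dstable_partial.
Qed.

Lemma dir_deriv_tofrac v (p : R) : dir_deriv v p%:F = (\sum_a v 0 a *: p^`M(a))%:F.
Proof.
rewrite raddf_sum; apply: eq_bigr => a _.
by rewrite /= frac_partial_tofrac /frac_const -mul_mpolyC tofracM.
Qed.

Lemma dir_deriv_tofrac_ex v (p : R) : exists q : R, dir_deriv v p%:F = q%:F.
Proof. by rewrite dir_deriv_tofrac; eexists. Qed.

Lemma affine_expand (p : R) : (msize p <= 2)%N ->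
  p = (p@_0)%:MP + \sum_a p@_U_(a) *: 'X_a.
Proof.
move=> p2; apply/mpolyP => k; rewrite mcoeffD mcoeffC raddf_sum /=.
under eq_bigr => a _ do rewrite mcoeffZ mcoeffX.
have [k0|k0] := eqVneq (mdeg k) 0%N.
  have -> : k = 0%MM by apply/eqP; rewrite -mdeg_eq0 k0.
  rewrite eqxx mulr1 big1 ?addr0 // => a _.
  by rewrite (_ : _ == _ = false) ?mulr0 //; apply/eqP => /(congr1 mdeg); rewrite mdeg1 mdeg0.
rewrite (_ : (k == 0%MM) = false) ?mulr0 ?add0r; last first.
  by rewrite -mdeg_eq0 (negPf k0).
have [k1|k1] := eqVneq (mdeg k) 1%N.
  have /mdeg1P[a /eqP ->] : mdeg k == 1%N by rewrite k1.
  rewrite (bigD1 a) //= eqxx mulr1 big1 ?addr0 // => b ba.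
  rewrite (_ : _ == _ = false) ?mulr0 //; apply/eqP => /(congr1 (fun m : 'X_{1..n} => m a)).
  by rewrite !mnm1E eqxx (negPf ba).
rewrite memN_msupp_eq0; last first.
  by apply/msize_mdeg_ge/(leq_trans p2); case: (mdeg k) k0 k1 => [|[|]].
rewrite big1 // => a _.
by rewrite (_ : _ == _ = false) ?mulr0 //; apply/eqP => E; rewrite -E mdeg1 in k1.
Qed.

Definition linpart (p : R) (v : 'rV[K]_n) : K := \sum_a v 0 a * p@_U_(a).

Lemma linpartD p : {morph linpart p : u v / u + v}.
Proof.
by move=> u v; rewrite -big_split; apply: eq_bigr => a _; rewrite mxE mulrDl.
Qed.

Lemma linpartZ p c v : linpart p (c *: v) = c * linpart p v.
Proof. by rewrite mulr_sumr; apply: eq_bigr => a _; rewrite mxE mulrA. Qed.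

Lemma linpart_sum p I (r : seq I) (P : pred I) (u : I -> 'rV[K]_n) :
  linpart p (\sum_(i <- r | P i) u i) = \sum_(i <- r | P i) linpart p (u i).
Proof.
by apply: (big_morph _ (linpartD p)); rewrite -[0](scale0r 0) linpartZ mul0r.
Qed.

Lemma linpart_delta p a : linpart p (delta_mx 0 a) = p@_U_(a).
Proof.
rewrite /linpart (bigD1 a) //= mxE !eqxx mul1r big1 ?addr0 // => b ba.
by rewrite mxE (negPf ba) mul0r.
Qed.

Lemma mderiv_affine (p : R) a : (msize p <= 2)%N -> p^`M(a) = (p@_U_(a))%:MP.
Proof.
move=> p2; rewrite {1}(affine_expand p2) mderivD mderivC add0r raddf_sum /=.
rewrite (bigD1 a) //= mderivZ mderivX mnm1E eqxx /= mulr1n -mul_mpolyC big1 => [|b ba].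
  rewrite addr0 (_ : (U_(a) - U_(a))%MM = 0%MM) ?mpolyX0.
    by rewrite scale1r mulr1.
  by apply/mnmP => b; rewrite mnmBE subnn mnm0E.
by rewrite mderivZ mderivX mnm1E (negPf ba) scale0r scaler0.
Qed.

Lemma dir_deriv_affine v (p : R) : (msize p <= 2)%N -> dir_deriv v p%:F =
  frac_const (linpart p v).
Proof.
move=> p2; rewrite dir_deriv_tofrac /frac_const /linpart; congr (_ %:F).
rewrite (raddf_sum (@mpolyC n K)); apply: eq_bigr => a _.
by rewrite mderiv_affine // -mul_mpolyC -mpolyCM.
Qed.

Lemma meval_affine (p : R) (x : 'rV[K]_n) : (msize p <= 2)%N ->
  p.@[x 0] = p@_0 + linpart p x.
Proof.
move=> p2; rewrite {1}(affine_expand p2) mevalD mevalC raddf_sum /=; congr (_ + _).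
by apply: eq_bigr => a _; rewrite mevalZ mevalXU mulrC.
Qed.

(** Taylor expansion at a zero *)
Lemma affine_center (p : R) (x : 'rV[K]_n) : (msize p <= 2)%N -> p.@[x 0] = 0 ->
  p = \sum_a ('X_a - (x 0 a)%:MP) * (p@_U_(a))%:MP.
Proof.
move=> p2; rewrite meval_affine // => /eqP; rewrite addr_eq0 => /eqP p0.
rewrite {1}(affine_expand p2) p0 mpolyCN /linpart raddf_sum addrC -sumrB.
by apply: eq_bigr => a _; rewrite mulrBl /= mpolyCM -mul_mpolyC ['X_a * _]mulrC.
Qed.

Lemma meval_affineD (p : R) (x v : 'rV[K]_n) : (msize p <= 2)%N ->
  p.@[(x + v) 0] = p.@[x 0] + linpart p v.
Proof. by move=> p2; rewrite !meval_affine // linpartD addrA. Qed.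

End DirectionalDerivative.

(** * Torsion along a polynomial *)

Section Saturation.
Variables (K : fieldType) (n : nat).
Local Notation R := {mpoly K[n]}.
Local Notation F := {fraction {mpoly K[n]}}.

Definition saturation (q : R) (N : set F) : set F :=
  [set x | exists k, N (q%:F ^+ k * x)]%classic.

(** Closure under derivatives:
    [q ^ (k + 1) * x' = (q ^ (k + 1) * x)' - (k + 1) * q' * (q ^ k * x)]. *)
Lemma dstable_saturation q N : dstable N -> dstable (saturation q N).
Proof.
move=> sN.
have mono k j x : N (q%:F ^+ k * x) -> N (q%:F ^+ (j + k) * x).
  by move=> Nx; rewrite exprD -mulrA -tofracXn; exact: dstableM.
split.
- by exists 0%N; rewrite mulr0; exact: dstable0.
- move=> x y [k Nx] [j Ny]; exists (j + k)%N; rewrite mulrDr; apply: dstableD => //.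
    exact: mono.
  by rewrite addnC; exact: mono.
- by move=> p x [k Nx]; exists k; rewrite mulrCA; exact: dstableM.
- move=> i x [k Nx]; exists k.+1.
  rewrite (_ : _ * _ = frac_partial i (q%:F ^+ k.+1 * x) -
      ((q^`M(i))%:F * (q%:F ^+ k * x)) *+ k.+1).
    apply: dstableB => //; first by apply: dstable_partial => //; exact: (mono _ 1%N).
    by rewrite -mulr_natl -[_%:R](rmorph_nat (@FracField.tofrac R)); do 2!apply: (dstableM sN).
  rewrite frac_partialM (derivation_exp (frac_partialM i)) frac_partial_tofrac.
  by rewrite mulrnAl -(mulrA (_ ^+ k)) (mulrCA (_ ^+ k)) addrAC subrr add0r.
Qed.

Lemma sub_saturation q N : (N `<=` saturation q N)%classic.
Proof. by move=> x Nx; exists 0%N; rewrite expr0 mul1r. Qed.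

End Saturation.

(** * Localizations at subsets of the forms *)

Section Localizations.
Variables (K : fieldType) (n m : nat) (l : 'I_m -> {mpoly K[n]}).
Local Notation R := {mpoly K[n]}.
Local Notation F := {fraction {mpoly K[n]}}.
Hypothesis l_neq0 : forall i, l i != 0.

Definition form_frac i : F := (l i)%:F.
Local Notation lF := form_frac.

Lemma form_frac_neq0 i : lF i != 0.
Proof. by rewrite tofrac_eq0. Qed.

Definition localization (S : {set 'I_m}) : set F := loc_set (\prod_(i in S) l i).
Local Notation locS := localization.

Lemma dstable_loc_set (f : R) : dstable (loc_set f).
Proof.
split.
- by rewrite -tofrac0; exact: in_loc_tofrac.
- exact: in_locD.
- by move=> p x; exact: in_locM_tofrac.
- by move=> i x; exact: in_loc_partial.
Qed.

Lemma dstable_localization S : dstable (locS S).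
Proof. exact: dstable_loc_set. Qed.

(** Allowing a separate pole order [k i] along each form makes it possible to lower
    the orders one at a time. *)
Definition pole_monomial (k : 'I_m -> nat) (S : {set 'I_m}) : F := \prod_(i in S) lF i ^- k i.
Local Notation ypow := pole_monomial.

Lemma localization_pole_monomial S p k : locS S (p%:F * ypow k S).
Proof.
pose N := (\sum_(i in S) k i)%N.
apply/in_locP; exists (p * \prod_(i in S) l i ^+ (N - k i)), N.
rewrite tofracM -mulrA; congr (_ * _).
rewrite -tofracXn -prodrXl !rmorph_prod -prodfV -big_split /=; apply: eq_bigr => i iS.
have kN : (k i <= N)%N by rewrite /N (bigD1 i) //= leq_addr.
have l0 := form_frac_neq0 i; rewrite !tofracXn -/(lF i).
apply: (mulIf (expf_neq0 N l0)); rewrite mulfVK ?expf_neq0 //.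
by rewrite -{1}(subnK kN) exprD mulrCA mulVf ?mulr1 ?expf_neq0.
Qed.

Lemma localizationP S x : locS S x <-> exists p k, x = p%:F * ypow k S.
Proof.
split=> [/in_locP[p [k ->]]|[p [k ->]]]; last exact: localization_pole_monomial.
exists p, (fun=> k); congr (_ * _).
by rewrite -tofracXn -prodrXl rmorph_prod -prodfV /=; apply: eq_bigr => i _; rewrite tofracXn.
Qed.

Lemma localization0 x : locS finset.set0 x <-> poly_set x.
Proof.
split=> [/localizationP[p [k ->]]|[p ->]].
  by exists p; rewrite /pole_monomial big_set0 mulr1.
exact: in_loc_tofrac.
Qed.

Lemma pole_monomial_mul (i : 'I_m) k k' (S : {set 'I_m}) : i \in S -> (forall j, k' j =
  k j + (j == i))%N ->
  lF i * ypow k' S = ypow k S.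
Proof.
move=> iS kk'; rewrite /pole_monomial (bigD1 i) //= [in RHS](bigD1 i) //= mulrA; congr (_ * _).
  by rewrite kk' eqxx addn1 exprS invfM mulrA divff ?form_frac_neq0 // mul1r.
by apply: eq_bigr => j /andP[_ /negPf ji]; rewrite kk' ji addn0.
Qed.

Lemma pole_monomial_drop i k S : k i = 0%N -> ypow k S = ypow k (S :\ i).
Proof.
move=> k0; have [iS|iS] := boolP (i \in S).
  rewrite /pole_monomial (big_setD1 i) //= k0 expr0 invr1 mul1r.
  by apply: eq_bigl => j; rewrite !inE.
by congr (ypow k _); apply/finset.setP => j; rewrite !inE; case: eqP => // ->;
  rewrite (negPf iS).
Qed.

Lemma localization_mono (S S' : {set 'I_m}) : S \subset S' -> (locS S `<=` locS S')%classic.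
Proof.
move=> SS' x /localizationP[p [k ->]]; apply/localizationP.
exists p, (fun i => if i \in S then k i else 0%N); congr (_ * _).
rewrite /pole_monomial [RHS](big_setID S) (finset.setIidPr SS') /= [X in _ * X]big1 ?mulr1.
  by apply: eq_bigr => i ->.
by move=> i; rewrite inE => /andP[/negPf -> _]; rewrite expr0 invr1.
Qed.

Lemma localization_div (S : {set 'I_m}) i x : i \in S -> locS S x -> locS S (x / lF i).
Proof.
move=> iS /localizationP[p [k ->]]; apply/localizationP; exists p, (fun j => k j + (j == i))%N.
by rewrite -(@pole_monomial_mul i k (fun j =>
  k j + (j == i))%N S) // mulrCA mulrAC divff ?mul1r // form_frac_neq0.
Qed.

Lemma pole_monomialU k (S S' : {set 'I_m}) : [disjoint S & S'] -> ypow k (S :|: S') =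
  ypow k S * ypow k S'.
Proof. by move=> dSS'; rewrite /pole_monomial -bigU //=; apply: eq_bigl => i; rewrite !inE. Qed.

Lemma localizationU (S S' : {set 'I_m}) x : [disjoint S & S'] ->
  locS (S :|: S') x <-> exists z k, locS S' z /\ x = z * ypow k S.
Proof.
move=> dSS'; split=> [/localizationP[p [k ->]]|[_ [k [/localizationP[p [k' ->]] ->]]]].
  exists (p%:F * ypow k S'), k; split; first exact: localization_pole_monomial.
  by rewrite pole_monomialU //; ring.
apply/localizationP; exists p, (fun i => if i \in S then k i else k' i).
rewrite pole_monomialU // [X in _ = _ * X]mulrC mulrA; congr (_ * _ * _); apply: eq_bigr =>
  i iS.
  by rewrite (disjointFl dSS' iS).
by rewrite iS.
Qed.

Lemma localization_saturation (S G : {set 'I_m}) : [disjoint S & G] ->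
  (locS (S :|: G) `<=` saturation (\prod_(i in G) l i) (locS S))%classic.
Proof.
move=> dSG x /in_locP[p [k ->]]; exists k; apply/in_locP; exists p, k.
have P0 (A : {set 'I_m}) : (\prod_(i in A) l i)%:F != 0.
  by rewrite tofrac_eq0; apply/prodf_neq0.
have -> : \prod_(i in S :|: G) l i = (\prod_(i in S) l i) * (\prod_(i in G) l i).
  by rewrite -bigU //=; apply: eq_bigl => i; rewrite !inE.
rewrite tofracM exprMn invfM mulrCA; congr (_ * _).
by rewrite mulrCA divff ?mulr1 // expf_neq0.
Qed.

Lemma dir_deriv_pole_monomial v k S :
  dir_deriv v (ypow k S) = (\sum_(i in S) - (dir_deriv v (lF i) / lF i) *+ k i) * ypow k S.
Proof.
rewrite /pole_monomial; apply: (derivation_prod (dir_derivM v)) => i _.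
exact: (derivation_expN (dir_derivM v) _ (form_frac_neq0 i)).
Qed.

(** The sum over [i] in [C] of the localizations in which [l i] is not inverted.  The
    quotient of [localization (C :|: G)] by it is the localization at [G] of the
    module of delta-functions along the common zeros of [C]. *)
Definition lower_poles (C G : {set 'I_m}) : set F :=
  [set x | exists u : 'I_m -> F,
     (forall i, i \in C -> locS (C :\ i :|: G) (u i)) /\ x = \sum_(i in C) u i]%classic.
Local Notation T := lower_poles.

Lemma dstable_lower_poles C G : dstable (T C G).
Proof.
have sL i := dstable_localization (C :\ i :|: G).
split.
- exists (fun=> 0); rewrite big1 //; split=> // i _; exact: dstable0.
- move=> _ _ [u [Lu ->]] [v [Lv ->]]; exists (fun i => u i + v i).
  by rewrite big_split; split=> // i iC; apply: dstableD; [exact: sL|exact: Lu|exact: Lv].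
- move=> p _ [u [Lu ->]]; exists (fun i => p%:F * u i).
  by rewrite mulr_sumr; split=> // i iC; apply: dstableM; [exact: sL|exact: Lu].
- move=> a _ [u [Lu ->]]; exists (fun i => frac_partial a (u i)).
  rewrite (derivation_sum (frac_partialD a)); split=> // i iC.
  by apply: dstable_partial; [exact: sL|exact: Lu].
Qed.

Lemma lower_poles_incl (C G : {set 'I_m}) i x : i \in C -> locS (C :\ i :|: G) x -> T C G x.
Proof.
move=> iC Lx; exists (fun j => if j == i then x else 0); split.
  move=> j jC; case: eqP => [->//|_]; apply: dstable0; exact: dstable_localization.
by rewrite (bigD1 i) //= eqxx big1 ?addr0 // => j /andP[_ /negPf ->].
Qed.

Lemma lower_poles_min (C G : {set 'I_m}) N : dstable N ->
  (forall i, i \in C -> (locS (C :\ i :|: G) `<=` N)%classic) -> (T C G `<=` N)%classic.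
Proof.
by move=> sN LN _ [u [Lu ->]]; apply: dstable_sum => // i iC; apply: (LN i iC); exact: Lu.
Qed.

Lemma lower_poles_sub (C G : {set 'I_m}) : (T C G `<=` locS (C :|: G))%classic.
Proof.
apply: lower_poles_min => [|i iC]; first exact: dstable_localization.
by apply: localization_mono; apply: finset.setSU; rewrite finset.subD1set.
Qed.

Lemma lower_poles_mono (C G G' : {set 'I_m}) : G \subset G' -> (T C G `<=` T C G')%classic.
Proof.
move=> GG'; apply: lower_poles_min => [|i iC x Lx]; first exact: dstable_lower_poles.
by apply: (lower_poles_incl iC); apply: localization_mono Lx; exact: finset.setUS.
Qed.

Lemma lower_poles_div (C G : {set 'I_m}) g x : g \in G -> T C G x -> T C G (x / lF g).
Proof.
move=> gG [u [Lu ->]]; exists (fun i => u i / lF g); rewrite mulr_suml; split=> // i iC.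
by apply: localization_div; [rewrite inE gG orbT|exact: Lu].
Qed.

(** The quotient of [localization (C :|: (g |: G))] by the left-hand side is the
    cokernel of the inclusion of the delta-module localized at [G] into its
    further localization at [g]; the right-hand side identifies this cokernel with
    a delta-module along a hyperplane section. *)
Lemma lower_poles_add_pole (C G : {set 'I_m}) g : g \notin C -> g \notin G ->
  sum_set (locS (C :|: G)) (T C (g |: G)) = T (g |: C) G.
Proof.
move=> gC gG; have CE : (g |: C) :\ g = C by rewrite finset.setU1K.
have DE i : i \in C -> (g |: C) :\ i :|: G = C :\ i :|: (g |: G).
  move=> iC; apply/finset.setP => j; rewrite !inE; case: (eqVneq j g) => [->|];
    rewrite ?orbT //=.
  by case: eqP gC => // ->; rewrite iC.
apply/seteqP; split=> [_ [a [b [La [u [Lu ->]] ->]]]|_ [u [Lu ->]]].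
  apply: dstableD; first exact: dstable_lower_poles.
    by apply: (@lower_poles_incl _ _ g); rewrite ?finset.setU11 // CE.
  apply: dstable_sum => [|i iC]; first exact: dstable_lower_poles.
  by apply: (@lower_poles_incl _ _ i); rewrite ?inE ?iC ?orbT // DE //; exact: Lu.
exists (u g), (\sum_(i in C) u i); rewrite big_setU1 //; split=> //.
  by rewrite -{1}CE; apply: Lu; rewrite finset.setU11.
by exists u; split=> // i iC; rewrite -DE //; apply: Lu; rewrite inE iC orbT.
Qed.

Lemma lower_poles_saturation (C G : {set 'I_m}) : [disjoint C & G] ->
  (T C G `<=` saturation (\prod_(i in G) l i) (T C finset.set0))%classic.
Proof.
move=> dCG; apply: lower_poles_min => [|i iC]; first by apply: dstable_saturation;
  exact: dstable_lower_poles.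
have dCi : [disjoint C :\ i & G] by apply: disjointWl dCG; exact: finset.subD1set.
move=> x /(localization_saturation dCi)[k Lx]; exists k; apply: (lower_poles_incl iC).
by rewrite finset.setU0.
Qed.

End Localizations.

(** * The Euler operator *)

Section Euler.
Variables (K : fieldType) (n : nat).
Local Notation R := {mpoly K[n]}.

Lemma euler_coef (p : R) k :
  (\sum_a 'X_a * p^`M(a))@_k = (mdeg k)%:R * p@_k.
Proof.
elim/mpolyind: p => [|c j p _ _ IH].
  by rewrite mcoeff0 mulr0 big1 ?mcoeff0 // => a _; rewrite mderiv0 mulr0.
have -> : \sum_a 'X_a * (c *: 'X_[j] + p)^`M(a) =
    (mdeg j)%:R * c *: 'X_[j] + \sum_a 'X_a * p^`M(a).
  under eq_bigr => a _ do rewrite mderivD mulrDr.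
  rewrite big_split; congr (_ + _) => /=.
  rewrite mdegE natr_sum mulr_suml scaler_suml; apply: eq_bigr => a _.
  rewrite mderivZ mderivX !scalerA -scalerAr [c * _]mulrC.
  have [->|ja] := eqVneq (j a) 0%N; first by rewrite mul0r !scale0r.
  rewrite -mpolyXD addmC.
  by rewrite submK //; apply/mnm_lepP => b; rewrite mnm1E; case: eqP => // <-; rewrite lt0n.
rewrite !mcoeffD IH mulrDr; congr (_ + _).
by rewrite !mcoeffZ mcoeffX; case: eqP => [->|]; rewrite ?mulr1 ?mulr0.
Qed.

Lemma msize_leP (p : R) d :
  reflect (forall k, (d <= mdeg k)%N -> p@_k = 0) (msize p <= d)%N.
Proof.
apply: (iffP idP) => [pd k dk|H].
  by apply: memN_msupp_eq0; apply: msize_mdeg_ge; exact: leq_trans dk.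
rewrite msizeE; apply/bigmax_leqP_seq => k kp _; rewrite leqNgt.
apply/negP; rewrite ltnS => /H pk0; by move: kp; rewrite mcoeff_msupp pk0 eqxx.
Qed.

Lemma msize_deriv (p : R) a d : (msize p <= d.+1)%N -> (msize p^`M(a) <= d)%N.
Proof.
move=> /msize_leP pd; apply/msize_leP => k dk; rewrite mcoeff_deriv pd ?mul0rn //.
by rewrite mdegD mdeg1 addn1.
Qed.

(** The Euler operator centred at the origin multiplies the leading form of [p] by its
    degree [d], and moving the centre only affects terms of lower degree. *)
Lemma msize_euler (p : R) (x : 'rV[K]_n) d : msize p = d.+1 ->
  (msize (\sum_a ('X_a - (x 0 a)%:MP) * p^`M(a) - d%:R *: p) <= d)%N.
Proof.
move=> pd; apply/msize_leP => k dk; rewrite mcoeffB mcoeffZ.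
under eq_bigr => a _ do rewrite mulrBl.
rewrite sumrB mcoeffB euler_coef [X in _ - X - _](_ : _ = 0) ?subr0; last first.
  rewrite raddf_sum big1 // => a _ /=; rewrite mcoeffCM.
  by have /msize_leP -> := @msize_deriv p a d (eq_leq pd); rewrite ?mulr0.
have [->|kd] := eqVneq (mdeg k) d; first by rewrite subrr.
have /msize_leP -> : (msize p <= d.+1)%N by rewrite pd.
  by rewrite !mulr0 subrr.
by rewrite ltn_neqAle eq_sym kd.
Qed.

End Euler.

(** * Sums over subsets *)

Section SubsetSums.
Variables (I : finType) (M : zmodType).

Lemma sum_subsets_setU1 (g : I) (G : {set I}) (H : {set I} -> M) : g \notin G ->
  \sum_(B : {set I} | B \subset g |: G) H B =
  \sum_(B : {set I} | B \subset G) H B + \sum_(B : {set I} | B \subset G) H (g |: B).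
Proof.
move=> gG; rewrite (bigID (fun B : {set I} => g \in B)) [LHS]addrC /=; congr (_ + _).
  apply: eq_bigl => B; apply/andP/idP => [[BG gB]|BG].
    by rewrite -(finset.setU1K gG) subsetD1 BG gB.
  split; first exact: fintype.subset_trans BG (finset.subsetUr _ _).
  by apply: contra gG; exact: (fintype.subsetP BG).
rewrite (reindex_onto (fun B => g |: B) (fun B => B :\ g)) /=; last first.
  by move=> B /andP[_ gB]; rewrite finset.setD1K.
apply: eq_bigl => B; rewrite !inE eqxx andbT /=.
apply/andP/idP => [[BG /eqP BE]|BG].
  have gB : g \notin B by rewrite -BE !inE eqxx.
  by rewrite -(finset.setU1K gG) -(finset.setU1K gB); exact: finset.setSD.
split; first exact: finset.setUS.
by rewrite finset.setU1K //; apply: contra gG; exact: (fintype.subsetP BG).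
Qed.

End SubsetSums.

(** Induction on pole orders lowers one exponent at a time. *)
Lemma exponent_decr (I : finType) (C : {set I}) (k : I -> nat) j :
  j \in C -> (0 < k j)%N -> exists2 k' : I -> nat,
    (forall i, k i = k' i + (i == j))%N &
    (\sum_(i in C) k i = (\sum_(i in C) k' i).+1)%N.
Proof.
move=> jC kj; pose k' i := (k i - (i == j))%N.
have kE i : k i = (k' i + (i == j))%N.
  by rewrite /k'; case: eqP => [->|_]; rewrite ?addn0 ?subn0 // subnK.
exists k' => //; under eq_bigr => i _ do rewrite kE.
rewrite big_split /= -addn1; congr (_ + _)%N.
by rewrite (bigD1 j) //= eqxx big1 // => i /andP[_ /negPf ->].
Qed.

(** * The module of delta-functions along a flat *)

Section Arrangements.
Variables (K : fieldType) (n m : nat) (l : 'I_m -> {mpoly K[n]}).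
Local Notation R := {mpoly K[n]}.
Local Notation F := {fraction {mpoly K[n]}}.
Local Notation V := 'rV[K]_n.
Hypothesis charK : [pchar K] =i pred0.
Hypothesis l_deg1 : forall i, msize (l i) = 2%N.

Lemma form_neq0 i : l i != 0.
Proof. by apply/eqP => li0; have := l_deg1 i; rewrite li0 msize0. Qed.

Lemma form_le2 i : (msize (l i) <= 2)%N.
Proof. by rewrite l_deg1. Qed.

#[local] Hint Resolve form_neq0 form_le2 : core.

Local Notation lF := (form_frac l).
Local Notation ypow := (pole_monomial l).
Local Notation locS := (localization l).
Local Notation T := (lower_poles l).
Local Notation set0 := (@finset.set0 'I_m).
Local Notation A := (arrangement l).
Let lF0 := form_frac_neq0 form_neq0.
Let sL := dstable_localization l.
Let sT := dstable_lower_poles l.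

Definition common_zeros (C : {set 'I_m}) : set V :=
  [set v : V | forall i, i \in C -> (l i).@[v 0] = 0]%classic.

(** The forms of [C] have linearly independent linear parts, as witnessed by vectors
    [d j] dual to them; the derivatives along these vectors act on poles like
    partial derivatives in coordinates that extend the forms. *)
Definition dual_vectors (C : {set 'I_m}) (d : 'I_m -> V) : Prop :=
  forall i j, i \in C -> j \in C -> linpart (l i) (d j) = (i == j)%:R.

Lemma natrK_neq0 k : (k.+1%:R : K) != 0.
Proof. by have /pcharf0P -> := charK. Qed.

Lemma frac_const_natV_mulrn k (x : F) : frac_const n (k.+1%:R^-1) * (x *+ k.+1) = x.
Proof.
rewrite mulrnAr -mulrnAl -rmorphMn -[_ *+ _]mulr_natr mulVf ?natrK_neq0 //.
by rewrite rmorph1 mul1r.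
Qed.

Lemma dstable_mulrnV (N : set F) k x : dstable N -> N (x *+ k.+1) -> N x.
Proof. by move=> sN Nx; rewrite -(frac_const_natV_mulrn k x); exact: dstableM. Qed.

Lemma common_zeros_neq0 C d : dual_vectors C d -> (common_zeros C !=set0)%classic.
Proof.
move=> dC; exists (\sum_(j in C) - (l j)@_0 *: d j) => i iC.
rewrite meval_affine ?form_le2 // linpart_sum (bigD1 i) //= linpartZ dC //.
rewrite eqxx mulr1 big1 ?addr0 ?subrr // => j /andP[jC ji].
by rewrite linpartZ dC // eq_sym (negPf ji) mulr0.
Qed.

(** The projection of the basis vector number [a] to the tangent space of the common
    zeros of [C], along the span of the dual vectors. *)
Definition tangent_vec (C : {set 'I_m}) (d : 'I_m -> V) a : V :=
  delta_mx 0 a - \sum_(i in C) linpart (l i) (delta_mx 0 a) *: d i.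

Lemma linpart_tangent_vec C d a i : dual_vectors C d -> i \in C ->
  linpart (l i) (tangent_vec C d a) = 0.
Proof.
move=> dC iC; rewrite linpartD -scaleN1r linpartZ linpart_sum (bigD1 i) //=.
rewrite linpartZ dC // eqxx mulr1 big1 ?addr0 ?mulN1r ?subrr // => j /andP[jC ji].
by rewrite linpartZ dC // eq_sym (negPf ji) mulr0.
Qed.

(** Its class modulo [lower_poles C set0] is the delta-function. *)
Definition delta (C : {set 'I_m}) : F := ypow (fun=> 1%N) C.

Lemma lower_poles_nilpotent (C : {set 'I_m}) i x : i \in C -> locS C x ->
  exists k, T C set0 (lF i ^+ k * x).
Proof.
move=> iC /(localizationP form_neq0)[p [k ->]]; exists (k i); apply: (lower_poles_incl iC).
rewrite finset.setU0 mulrCA /pole_monomial (big_setD1 i) //= mulVKf ?expf_neq0 //.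
exact: localization_pole_monomial.
Qed.

Lemma lower_poles_pole_monomial0 (C : {set 'I_m}) i p k : i \in C -> k i = 0%N ->
  T C set0 (p%:F * ypow k C).
Proof.
move=> iC k0; apply: (lower_poles_incl iC); rewrite finset.setU0 (pole_monomial_drop l C k0).
exact: localization_pole_monomial.
Qed.

Lemma lower_poles_delta_mul (C : {set 'I_m}) i p : i \in C ->
  T C set0 (p%:F * (lF i * delta C)).
Proof.
move=> iC; pose k j := (1 - (j == i))%N.
rewrite (@pole_monomial_mul _ _ _ _ form_neq0 i k) //; last first.
  by move=> j; rewrite /k; case: (j == i).
by apply: (lower_poles_pole_monomial0 p iC); rewrite /k eqxx.
Qed.

(** Modulo [T C set0] every form of [C] acts nilpotently, so multiplying [u] by as
    high a power as possible of each form in turn leads to an element that all of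
    them kill. *)
Lemma exists_socle (C : {set 'I_m}) (N : set F) u : dstable N -> (N `<=` locS C)%classic ->
  N u -> ~ T C set0 u ->
  exists v, [/\ N v, ~ T C set0 v & forall i, i \in C -> T C set0 (lF i * v)].
Proof.
move=> sN NL Nu Tu.
have H (s : seq 'I_m) : {subset s <= C} ->
    exists v, [/\ N v, ~ T C set0 v & forall i, i \in s -> T C set0 (lF i * v)].
  elim: s => [_|i s IH sC]; first by exists u.
  have [j js|v [Nv Tv sv]] := IH; first by apply: sC; rewrite inE js orbT.
  have iC : i \in C by apply: sC; rewrite inE eqxx.
  have Tk : exists k, `[< T C set0 (lF i ^+ k * v) >].
    by have [k Tk] := lower_poles_nilpotent iC (NL _ Nv); exists k; apply/asboolP.
  case: (ex_minnP Tk) => -[/asboolP|k /asboolP Tkv mink]; first by rewrite mul1r.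
  exists (lF i ^+ k * v); split.
  - by rewrite -tofracXn; exact: dstableM.
  - by move=> /asboolP /mink; rewrite ltnn.
  - move=> j; rewrite inE => /predU1P[->|js]; first by rewrite mulrA -exprS.
    by rewrite mulrCA -tofracXn; apply: (dstableM (sT _ _)); exact: sv.
have [i|v [Nv Tv Hv]] := H (enum C); first by rewrite mem_enum.
by exists v; split=> // i iC; apply: Hv; rewrite mem_enum.
Qed.

Section Independent.
Variables (C : {set 'I_m}) (d : 'I_m -> V).
Hypothesis dC : dual_vectors C d.
Local Notation TC := (T C set0).
Local Notation delta := (delta C).
Let sTC : dstable TC := sT C set0.

Lemma dir_deriv_dual i j : i \in C -> j \in C -> dir_deriv (d j) (lF i) = (i == j)%:R.
Proof. by move=> iC jC; rewrite dir_deriv_affine ?form_le2 // dC // rmorph_nat. Qed.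

Lemma dir_deriv_pole_monomial_dual j k : j \in C ->
  dir_deriv (d j) (ypow k C) = - (ypow k C / lF j *+ k j).
Proof.
move=> jC; rewrite (dir_deriv_pole_monomial form_neq0) (bigD1 j) //=.
rewrite dir_deriv_dual // eqxx big1 => [|i /andP[iC ij]].
  by rewrite addr0 mul1r mulNrn mulNr mulrnAl mulrC.
by rewrite dir_deriv_dual // (negPf ij) mul0r oppr0 mul0rn.
Qed.

(** Derivatives along tangent vectors do not see the poles. *)
Lemma dir_deriv_pole_monomial_tangent v k : (forall i, i \in C -> linpart (l i) v = 0) ->
  dir_deriv v (ypow k C) = 0.
Proof.
move=> vC; rewrite (dir_deriv_pole_monomial form_neq0) big1 ?mul0r // => i iC.
by rewrite dir_deriv_affine ?form_le2 // vC // rmorph0 mul0r oppr0 mul0rn.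
Qed.

Definition form_monomial (b : 'I_m -> nat) : F := \prod_(i in C) lF i ^+ b i.

(** The ideal generated by the powers [l i ^ b i], [i] in [C], inside [F]; the
    derivative along [d j] sends it into the ideal with [b j] lowered by one. *)
Definition powers_ideal (b : 'I_m -> nat) : set F :=
  [set x | exists q : 'I_m -> R, x = \sum_(i in C) (q i)%:F * lF i ^+ b i]%classic.
Local Notation J := powers_ideal.

Lemma powers_idealD b x y : J b x -> J b y -> J b (x + y).
Proof.
move=> [q ->] [r ->]; exists (fun i => q i + r i); rewrite -big_split.
by apply: eq_bigr => i _; rewrite tofracD mulrDl.
Qed.

Lemma powers_idealM b (p : R) x : J b x -> J b (p%:F * x).
Proof.
move=> [q ->]; exists (fun i => p * q i); rewrite mulr_sumr.
by apply: eq_bigr => i _; rewrite tofracM mulrA.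
Qed.

Lemma powers_ideal_incl b i e (p : R) : i \in C -> (b i <= e)%N -> J b (p%:F * lF i ^+ e).
Proof.
move=> iC be; exists (fun j => if j == i then p * l i ^+ (e - b i) else 0).
rewrite (bigD1 i) //= eqxx big1 => [|j /andP[_ /negPf ->]]; last by rewrite tofrac0 mul0r.
by rewrite addr0 tofracM tofracXn -mulrA -exprD subnK.
Qed.

Lemma powers_ideal_sum b I (r : seq I) (P : pred I) u :
  (forall i, P i -> J b (u i)) -> J b (\sum_(i <- r | P i) u i).
Proof.
move=> Ju; elim/big_ind: _ => //; last exact: powers_idealD.
by exists (fun=> 0); rewrite big1 // => i _; rewrite tofrac0 mul0r.
Qed.

Lemma dir_deriv_form_monomial j b : j \in C ->
  dir_deriv (d j) (form_monomial b) * lF j = form_monomial b *+ b j.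
Proof.
move=> jC; rewrite /form_monomial (derivation_prod (dir_derivM (d j)) _
    (c := fun i => (dir_deriv (d j) (lF i) / lF i) *+ b i)) => [|i iC]; last first.
  case: (b i) => [|e]; first by rewrite expr0 (derivation1 (dir_derivM (d j))) mulr0n mul0r.
  rewrite (derivation_exp (dir_derivM (d j))) mulrnAl; congr (_ *+ _).
  by rewrite exprS mulrA mulfVK ?lF0 // mulrC.
rewrite (bigD1 j) //= dir_deriv_dual // eqxx big1 ?addr0 => [|i /andP[iC ij]]; last first.
  by rewrite dir_deriv_dual // (negPf ij) mul0r mul0rn.
by rewrite mul1r !mulrnAl mulrC mulrA divff ?mul1r // lF0.
Qed.

Lemma form_monomial_split j b : j \in C -> exists r : R, form_monomial b = r%:F * lF j ^+ b j.
Proof.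
move=> jC; exists (\prod_(i in C | i != j) l i ^+ b i).
rewrite /form_monomial (bigD1 j) //= mulrC; congr (_ * _).
by rewrite rmorph_prod; apply: eq_bigr => i _; rewrite /= tofracXn.
Qed.

(** Differentiating a relation [p * l^b = \sum_i q_i * l_i ^ (b_i + 1)] along [d j]
    gives the relation with [b j] lowered by one, up to the factor [b j], nonzero in
    characteristic zero.  At [b = 0] the polynomial [p] is a combination of the forms. *)
Lemma powers_ideal_eval b (p : R) (x : V) : J (fun i => (b i).+1) (p%:F * form_monomial b) ->
  common_zeros C x -> p.@[x 0] = 0.
Proof.
move=> Jp Xx; have [s] := ubnP (\sum_(i in C) b i); elim: s b Jp => // s IH b [q Eq] bs.
have [/exists_inP[j jC bj]|b0] := boolP [exists j in C, (0 < b j)%N]; last first.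
  have {}b0 i : i \in C -> b i = 0%N.
    by move=> iC; case E: (b i) => // [e]; case/exists_inP: b0; exists i; rewrite ?E.
  have : p = \sum_(i in C) q i * l i.
    apply/eqP; rewrite -tofrac_eq rmorph_sum -[p%:F]mulr1.
    rewrite (_ : 1 = form_monomial b); last by rewrite /form_monomial big1 // => i /b0 ->.
    by rewrite Eq; apply/eqP; apply: eq_bigr => i iC; rewrite b0 // expr1 /= tofracM.
  by move=> ->; rewrite rmorph_sum big1 // => i iC; rewrite rmorphM /= Xx // mulr0.
have [b' bE sb'] := exponent_decr jC bj.
have b'j : b j = (b' j).+1 by rewrite bE eqxx addn1.
have b'i i : i != j -> b' i = b i by move=> /negPf ij; rewrite bE ij addn0.
have b'_le i : (b' i <= b i)%N by rewrite bE leq_addr.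
apply: (IH b'); last by move: bs; rewrite sb' ltnS.
have hb : form_monomial b = lF j * form_monomial b'.
  rewrite /form_monomial (bigD1 j) //= [in RHS](bigD1 j) //= mulrA -exprS -b'j; congr (_ * _).
  by apply: eq_bigr => i /andP[_ ij]; rewrite b'i.
have := congr1 (dir_deriv (d j)) Eq; rewrite dir_derivM.
have -> : dir_deriv (d j) (form_monomial b) = form_monomial b' *+ b j.
  by apply: (mulIf (lF0 j)); rewrite dir_deriv_form_monomial // hb mulrnAl mulrC.
move=> {}Eq; have [r Er] := form_monomial_split b jC;
  have [p' Ep'] := dir_deriv_tofrac_ex (d j) p.
have JE : J (fun i => (b' i).+1) (p%:F * (form_monomial b' *+ (b' j).+1)).
  rewrite -b'j -[_ * _](addKr (dir_deriv (d j) p%:F * form_monomial b)) {}Eq.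
  apply: powers_idealD.
    rewrite Ep' Er mulrA -tofracM -mulNr -tofracN.
    by apply: powers_ideal_incl => //; rewrite b'j.
  rewrite (big_morph _ (dir_derivD (d j)) (derivation0 (dir_derivD (d j)))).
  apply: powers_ideal_sum => i iC; rewrite dir_derivM;
    have [q' ->] := dir_deriv_tofrac_ex (d j) (q i).
  apply: powers_idealD; first by apply: powers_ideal_incl => //; rewrite ltnS.
  rewrite (derivation_exp (dir_derivM (d j))) dir_deriv_dual //.
  have [ij|ij] := eqVneq i j.
    rewrite mulr1 mulrnAr -mulrnAl -rmorphMn /=.
    by apply: powers_ideal_incl => //; rewrite ij b'j.
  rewrite mulr0 mul0rn mulr0 -(mul0r (lF i ^+ (b i).+1)) -tofrac0.
  by apply: powers_ideal_incl => //; rewrite ltnS.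
rewrite -(frac_const_natV_mulrn (b' j) (form_monomial b')) mulrCA; exact: powers_idealM.
Qed.

Lemma form_monomial_const N : form_monomial (fun=> N) = (\prod_(i in C) l i)%:F ^+ N.
Proof. by rewrite rmorph_prod -prodrXl. Qed.

(** The annihilator of the delta-function consists of polynomials that vanish on the
    flat; in particular the delta-function is not zero.  Multiplying by a high
    power of all forms turns membership in [T C set0] into a polynomial relation. *)
Lemma lower_poles_delta_eval (p : R) (x : V) : T C finset.set0 (p%:F * delta) ->
  common_zeros C x ->
  p.@[x 0] = 0.
Proof.
move=> [u [Lu Eu]] Xx.
have /boolp.choice[k kP] : forall i, exists k, forall N, (k <= N)%N -> i \in C ->
    exists q : R, form_monomial (fun=> N) * u i = q%:F * lF i ^+ N.
  move=> i; have [iC|iC] := boolP (i \in C); last by exists 0%N => N _ iC'; case/negP: iC.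
  have /in_locP[q [k Ek]] := Lu i iC; exists k => N kN _.
  exists (q * (\prod_(j in C :\ i) l j) ^+ (N - k)).
  rewrite form_monomial_const (big_setD1 i) //= tofracM exprMn Ek finset.setU0 tofracM tofracXn.
  set z := (\prod_(_ in _) _)%:F.
  have z0 : z != 0.
    by rewrite tofrac_eq0; apply/prodf_neq0 => j _; exact: form_neq0.
  clearbody z; have -> : z ^+ (N - k) = z ^+ N / z ^+ k.
    have zk0 : z ^+ k != 0 by rewrite expf_neq0.
    have E : z ^+ N = z ^+ (N - k) * z ^+ k by rewrite -exprD subnK.
    by rewrite E mulfK.
  by move: (z ^+ N) ((z ^+ k)^-1) (lF i ^+ N) => a b c; ring.
pose N := \max_i k i.
have /boolp.choice[q qP] : forall i, exists q : R, i \in C ->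
    form_monomial (fun=> N.+1) * u i = q%:F * lF i ^+ N.+1.
  move=> i; have [iC|iC] := boolP (i \in C); last by exists 0 => iC'; case/negP: iC.
  have kN : (k i <= N.+1)%N by apply: leqW; exact: leq_bigmax.
  by have [q qE] := kP i _ kN iC; exists q.
apply: (@powers_ideal_eval (fun=> N)) => //; exists q.
have -> : form_monomial (fun=> N) = form_monomial (fun=> N.+1) * delta.
  rewrite /form_monomial /delta /pole_monomial -big_split; apply: eq_bigr => i _ /=.
  by rewrite expr1 exprS mulrAC divff ?mul1r ?lF0.
by rewrite mulrCA Eu mulr_sumr; apply: eq_bigr => i iC; rewrite qP.
Qed.

(** If [l_j * u = 0] modulo [T C set0] and [u] has a pole of order [k] along [l_j],
    then [0 = d_j (l_j * u) = u + l_j * d_j u], where [l_j * d_j u] is [- k * u] up to a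
    term of lower pole order.  So for [k > 1] the order of the pole can be lowered, and
    in the end [u] is a multiple of the delta-function. *)
Lemma socle_delta (N : set F) u : dstable N -> (TC `<=` N)%classic ->
  (N `<=` locS C)%classic -> N u -> ~ TC u -> (forall i, i \in C -> TC (lF i * u)) ->
  exists p, N (p%:F * delta) /\ ~ TC (p%:F * delta).
Proof.
move=> sN TN NL Nu Tu Hu; have /(localizationP form_neq0)[p [k E]] := NL _ Nu.
have [s] := ubnP (\sum_(i in C) k i); elim: s u p k E Nu Tu Hu => // s IH u p k E Nu Tu Hu ks.
have k0 i : i \in C -> (0 < k i)%N.
  by move=> iC; rewrite lt0n; apply/eqP => /(lower_poles_pole_monomial0 p iC); rewrite -E.
have [/exists_inP[j jC kj]|k1] := boolP [exists j in C, (1 < k j)%N]; last first.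
  exists p; suff <- : u = p%:F * delta by [].
  rewrite E /pole_monomial; congr (_ * _); apply: eq_bigr => i iC; congr (_ ^- _); apply/eqP.
  by rewrite eqn_leq k0 // andbT leqNgt; apply/negP => ki; case/exists_inP: k1; exists i.
have [k' kE sk'] := exponent_decr jC (ltnW kj).
have yk' : lF j * ypow k C = ypow k' C by apply: pole_monomial_mul.
have [q Eq] := dir_deriv_tofrac_ex (d j) p.
pose c := (k j).-2.
have kjc : k j = c.+2 by rewrite /c; case: (k j) kj => [|[|]].
(* this is the negative of the derivative of [l_j * u] *)
have Tq : TC (u *+ c.+1 - q%:F * ypow k' C).
  have E1 : lF j * dir_deriv (d j) u = q%:F * ypow k' C - u *+ c.+2.
    rewrite E dir_derivM Eq dir_deriv_pole_monomial_dual // kjc -yk' mulrDr !mulrN.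
    rewrite !mulrnAr; congr (_ - _ *+ _); first by rewrite mulrCA.
    by rewrite mulrCA [lF j * _]mulrC mulfVK.
  have := dstable_opp sTC (dstable_dir_deriv (d j) sTC (Hu j jC)).
  rewrite dir_derivM dir_deriv_dual // eqxx mul1r E1 mulrS.
  by move: (u *+ c.+1) (q%:F * _) => B A; congr (TC _); ring.
have Nq : N (q%:F * ypow k' C).
  rewrite -[X in N X](subKr (u *+ c.+1)); apply: dstableB => //; last exact: TN.
  by rewrite -mulr_natl -[_%:R](rmorph_nat (@FracField.tofrac R)); exact: dstableM.
have [|i iC||r Hr] := IH _ q k' erefl Nq; last by exists r.
- move=> Tq'; apply: Tu; apply: (dstable_mulrnV (k := c) sTC).
  by rewrite -[X in TC X](subrK (q%:F * ypow k' C)); exact: dstableD.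
- rewrite -[_ * ypow _ _](subKr (u *+ c.+1)) mulrBr; apply: dstableB => //.
    by rewrite mulrnAr -mulr_natl -[_%:R](rmorph_nat (@FracField.tofrac R));
       apply: dstableM => //; exact: Hu.
  exact: dstableM.
- by move: ks; rewrite sk' ltnS.
Qed.

(** Take [p] of least degree [D].  Derivatives of [p] tangent to the flat have
    smaller degree, so they kill the delta-function, and then so does [E p] for the
    Euler operator [E] centred at a point of the flat, which is a combination of
    tangent derivatives and of derivatives multiplied by forms of [C].  Since
    [E p - D * p] has degree less than [D], it kills the delta-function too.
    Hence so does [D * p], which forces [D = 0]. *)
Lemma delta_in (N : set F) : dstable N -> (TC `<=` N)%classic ->
  (exists p, N (p%:F * delta) /\ ~ TC (p%:F * delta)) -> N delta.
Proof.
move=> sN TN exp.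
have [x0 Xx0] := common_zeros_neq0 dC.
pose P s := `[< exists p, [/\ N (p%:F * delta), ~ TC (p%:F * delta) & msize p = s] >].
have exP : exists s, P s by case: exp => p [Np Tp]; exists (msize p); apply/asboolP; exists p.
case: (ex_minnP exP) => s /asboolP[p [Np Tp ps]] mins.
have small q : N (q%:F * delta) -> (msize q < s)%N -> TC (q%:F * delta).
  move=> Nq qs; apply: contrapT => Tq; have : P (msize q) by apply/asboolP; exists q.
  by move=> /mins; rewrite leqNgt qs.
case: s ps mins small => [|D] ps mins small.
  by case: Tp; move/eqP: ps; rewrite msize_poly_eq0 => /eqP->; rewrite tofrac0 mul0r;
    exact: dstable0.
pose E := \sum_a ('X_a - (x0 0 a)%:MP) * p^`M(a).
have TE : TC (E%:F * delta).
  pose v := tangent_vec C d.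
  have vC a i : i \in C -> linpart (l i) (v a) = 0 by exact: linpart_tangent_vec.
  have Tv a : TC (dir_deriv (v a) p%:F * delta).
    rewrite dir_deriv_tofrac; apply: small; last first.
      rewrite ltnS; apply/msize_leP => k Dk; rewrite raddf_sum big1 // => b _ /=.
      rewrite mcoeffZ; have /msize_leP -> := @msize_deriv _ _ p b D (eq_leq ps) => //.
      by rewrite mulr0.
    have := dstable_dir_deriv (v a) sN Np; rewrite dir_derivM dir_deriv_tofrac.
    by rewrite dir_deriv_pole_monomial_tangent ?mulr0 ?addr0 // => i iC; exact: vC.
  (* the coordinate derivatives split into tangent and normal parts, and the normal
     part of the Euler operator is [\sum_i l_i * d_i] by Taylor expansion at [x0] *)
  have -> : E%:F = \sum_a ('X_a - (x0 0 a)%:MP)%:F * dir_deriv (v a) p%:F +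
      \sum_(i in C) lF i * dir_deriv (d i) p%:F.
    have lE i : i \in C ->
        lF i = \sum_a ('X_a - (x0 0 a)%:MP)%:F * frac_const n (linpart (l i) (delta_mx 0 a)).
      move=> iC; rewrite /form_frac {1}(affine_center (form_le2 i) (Xx0 i iC)) rmorph_sum.
      by apply: eq_bigr => a _; rewrite linpart_delta /= tofracM.
    under [X in _ = _ + X]eq_bigr => i iC do rewrite (lE i iC) mulr_suml.
    rewrite exchange_big -big_split rmorph_sum; apply: eq_bigr => a _ /=.
    rewrite tofracM -frac_partial_tofrac /v /tangent_vec dir_derivBl dir_deriv_delta dir_deriv_suml.
    rewrite mulrBr -[LHS]addr0 -addrA; congr (_ + _).
    rewrite mulr_sumr -sumrN -big_split big1 // => i iC /=.
    by rewrite dir_derivZl mulrA addNr.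
  rewrite mulrDl !mulr_suml; apply: (dstableD sTC).
    by apply: (@dstable_sum _ _ _ _ _ _ _ sTC) => a _; rewrite -mulrA; exact: dstableM.
  apply: (@dstable_sum _ _ _ _ _ _ _ sTC) => i iC.
  have [q ->] := dir_deriv_tofrac_ex (d i) p.
  by rewrite [lF i * _]mulrC -mulrA; exact: lower_poles_delta_mul.
have TD : TC ((D%:R *: p)%:F * delta).
  have -> : D%:R *: p = E - (E - D%:R *: p) by rewrite opprB addrC subrK.
  rewrite tofracB mulrBl; apply: (dstableB sTC) => //; apply: small.
    rewrite tofracB mulrBl; apply: dstableB => //; first exact: TN.
    by rewrite -mul_mpolyC tofracM -mulrA; exact: dstableM.
  by rewrite ltnS; exact: msize_euler.
case: D ps TD {mins small} => [|D] ps TD; last first.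
  case: Tp; apply: (dstable_mulrnV (k := D) sTC).
  by rewrite -mulrnAl -rmorphMn /= -scaler_nat.
have /msize_poly1P[c c0 pc] : msize p == 1%N by rewrite ps.
rewrite -[delta]mul1r -(rmorph1 (frac_const n)) -(mulVf c0) rmorphM -mulrA.
by apply: dstableM => //; move: Np; rewrite pc.
Qed.

(** Derivatives along the dual vectors produce poles of all orders, up to nonzero
    integer factors. *)
Lemma delta_gen (N : set F) : dstable N -> N delta -> (locS C `<=` N)%classic.
Proof.
move=> sN Nd.
have H s k : (\sum_(i in C) k i < s)%N -> N (ypow (fun i => (k i).+1) C).
  elim: s k => // s IH k ks.
  have [/exists_inP[j jC kj]|k0] := boolP [exists j in C, (0 < k j)%N]; last first.
    suff -> : ypow (fun i => (k i).+1) C = delta by [].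
    apply: eq_bigr => i iC; congr (_ ^- _.+1); apply/eqP.
    by rewrite -leqn0 leqNgt; apply/negP => ki; case/exists_inP: k0; exists i.
  have [k' kE sk'] := exponent_decr jC kj.
  have k's : (\sum_(i in C) k' i < s)%N by move: ks; rewrite sk' ltnS.
  move: (IH k' k's) => /(dstable_dir_deriv (d j) sN); rewrite dir_deriv_pole_monomial_dual //.
  move/(dstable_opp sN); rewrite opprK => /(dstable_mulrnV sN).
  rewrite -(@pole_monomial_mul _ _ _ _ form_neq0 j (fun i => (k' i).+1) (fun i => (k i).+1)) //.
    by rewrite mulrC mulKf.
  by move=> i; rewrite [in LHS]kE addSn.
move=> x /(localizationP form_neq0)[p [k ->]]; apply: dstableM => //.
have -> : ypow k C = (\prod_(i in C) l i)%:F * ypow (fun i => (k i).+1) C.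
  rewrite rmorph_prod /pole_monomial -big_split; apply: eq_bigr => i _ /=.
  by rewrite -/(lF i) exprS invfM mulVKf.
by apply: dstableM => //; apply: H; exact: ltnSn.
Qed.

(** Simplicity of the module of delta-functions: a nonzero submodule meets the socle,
    contains the delta-function, and is therefore everything. *)
Lemma covers_lower_poles : covers TC (locS C).
Proof.
have TL : (TC `<=` locS C)%classic by have := @lower_poles_sub _ _ _ l form_neq0 C set0;
  rewrite finset.setU0.
split=> //.
  move=> E; have [x Xx] := common_zeros_neq0 dC.
  have Td : TC (1%:F * delta) by rewrite E; exact: localization_pole_monomial.
  have /eqP := lower_poles_delta_eval Td Xx; rewrite rmorph1; exact/negP/oner_neq0.
move=> N sN TN NL; have [[u [Nu Tu]]|H] := pselect (exists u, N u /\ ~ TC u).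
  right; apply/seteqP; split=> //; apply: delta_gen => //; apply: delta_in => //.
  have [v [Nv Tv Hv]] := exists_socle sN NL Nu Tu.
  exact: (socle_delta sN TN NL Nv Tv Hv).
left; apply/seteqP; split=> // x Nx; apply: contrapT => Tx; apply: H; by exists x.
Qed.

End Independent.

(** * Inverting one more form *)

Definition vanishes (C : {set 'I_m}) (g : 'I_m) : Prop :=
  (common_zeros C `<=` zero_locus (l g))%classic.

Lemma vanishes_mem (C : {set 'I_m}) g : g \in C -> vanishes C g.
Proof. by move=> gC x; apply. Qed.

(** A form that does not vanish on the flat is a nonzerodivisor on the delta-module: its
    torsion is a submodule, hence zero or everything, and in the latter case a power of
    the form would kill the delta-function. *)
Lemma lower_poles_regular (C : {set 'I_m}) d g y : dual_vectors C d -> ~ vanishes C g ->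
  locS C y -> T C set0 (lF g * y) -> T C set0 y.
Proof.
move=> dC Cg Ly Tgy; set TC := T C set0.
have sTC : dstable TC := sT C set0.
have TL : (TC `<=` locS C)%classic := cover_sub (covers_lower_poles dC).
pose Z : set F := (saturation (l g) TC `&` locS C)%classic.
have sZ : dstable Z by apply: dstableI (sL C); exact: dstable_saturation.
have TZ : (TC `<=` Z)%classic by move=> x Tx; split; [exact: sub_saturation|exact: TL].
have ZL : (Z `<=` locS C)%classic by move=> x [].
have [ZE|ZE] := cover_simple (covers_lower_poles dC) sZ TZ ZL.
  have : Z y by split=> //; exists 1%N.
  by rewrite ZE.
case: Cg => x Xx.
have : Z (delta C) by rewrite ZE -[delta C]mul1r;
  exact: (localization_pole_monomial form_neq0 _ 1).
move=> [[k]]; rewrite -tofracXn => /lower_poles_delta_eval => /(_ d dC x Xx) /eqP.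
by rewrite rmorphXn expf_eq0 => /andP[_ /eqP].
Qed.

Lemma nonvanishing_disjoint (C G : {set 'I_m}) :
  (forall g, g \in G -> ~ vanishes C g) -> [disjoint C & G].
Proof.
move=> CG; rewrite disjoint_sym; apply/pred0P => i /=; apply/andP => -[iG iC].
exact: CG iG (vanishes_mem iC).
Qed.

Lemma lower_poles_regular_prod (C : {set 'I_m}) d (G : {set 'I_m}) k y : dual_vectors C d ->
  (forall g, g \in G -> ~ vanishes C g) ->
  locS C y -> T C set0 ((\prod_(g in G) l g)%:F ^+ k * y) -> T C set0 y.
Proof.
move=> dC CG.
have H (s : seq 'I_m) z : {subset s <= G} -> locS C z ->
    T C set0 ((\prod_(g <- s) l g)%:F * z) -> T C set0 z.
  elim: s z => [|g s IH] z sG Lz; first by rewrite big_nil tofrac1 mul1r.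
  have gG : g \in G by apply: sG; rewrite inE eqxx.
  have sG' : {subset s <= G} by move=> j js; apply: sG; rewrite inE js orbT.
  rewrite big_cons tofracM -mulrA => Tg; apply: (IH z sG' Lz).
  by apply: (lower_poles_regular dC (CG _ gG)) Tg; exact: (dstableM (sL C)).
elim: k y => [|k IH] y Ly; first by rewrite mul1r.
rewrite exprS -mulrA => Ty; apply: IH => //.
apply: (H (enum G)); [by move=> g; rewrite mem_enum| |by rewrite big_enum].
by rewrite -tofracXn; exact: (dstableM (sL C)).
Qed.

(** Inverting further forms creates no relations.  Clearing the denominators coming from
    [G] reduces this to the nonzerodivisor property for [G] empty. *)
Lemma lower_poles_cap (C : {set 'I_m}) d (G G' : {set 'I_m}) : dual_vectors C d ->
  G' \subset G ->
  (forall g, g \in G -> ~ vanishes C g) ->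
  (locS (C :|: G') `&` T C G)%classic = T C G'.
Proof.
move=> dC GG' CG; have CG' g : g \in G' -> ~ vanishes C g.
  by move=> gG'; apply: CG; exact: (fintype.subsetP GG').
apply/seteqP; split=> x; last first.
  move=> Tx; split; first exact: lower_poles_sub form_neq0 _ _ _ Tx.
  exact: lower_poles_mono form_neq0 _ _ _ GG' _ Tx.
move=> [/(localization_saturation form_neq0 (nonvanishing_disjoint CG'))[a La]].
move=> /(lower_poles_saturation form_neq0 (nonvanishing_disjoint CG))[b Tb].
have : T C set0 ((\prod_(g in G') l g)%:F ^+ a * x).
  apply: (lower_poles_regular_prod (k := b) dC CG La).
  by rewrite mulrCA -tofracXn; exact: (dstableM (sT C set0)).
move/(lower_poles_mono form_neq0 (finset.sub0set G')).
have H (s : seq 'I_m) z : {subset s <= G'} -> T C G' ((\prod_(g <- s) l g)%:F * z) -> T C G' z.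
  elim: s z => [|g s IH] z sG; first by rewrite big_nil tofrac1 mul1r.
  have gG : g \in G' by apply: sG; rewrite inE eqxx.
  have sG' : {subset s <= G'} by move=> j js; apply: sG; rewrite inE js orbT.
  rewrite big_cons tofracM -mulrA => /(lower_poles_div form_neq0 gG).
  by rewrite -/(lF g) mulrC (mulKf (lF0 g)); exact: IH.
elim: a {La} => [|a IH]; first by rewrite mul1r.
rewrite exprS -mulrA => Ty; apply: IH.
by apply: (H (enum G')); [move=> g; rewrite mem_enum|rewrite big_enum].
Qed.

(** If [l g] is congruent modulo the forms of [C] to something invertible, a pole along
    [l g] is not new: [x / l_g = x / r - \sum_i a_i * l_i * (x / r) / l_g], where the poles
    along the forms of [C] have smaller order in the sum on the right. *)
Lemma localization_add_unit (C G : {set 'I_m}) g (r : F) (a : 'I_m -> K) :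
  g \notin C -> g \notin G -> [disjoint C & G] -> r != 0 ->
  (forall z, locS G z -> locS G (z / r)) ->
  lF g = r + \sum_(i in C) frac_const n (a i) * lF i ->
  sum_set (locS (C :|: G)) (T C (g |: G)) = locS (C :|: (g |: G)).
Proof.
move=> gC gG dCG r0 Lr Eg; set E := sum_set _ _.
have sE : dstable E by apply: dstable_sum_set; [exact: sL|exact: sT].
have LE x : locS (C :|: G) x -> E x.
  by move=> Lx; exists x, 0; rewrite addr0; split=> //; exact: (dstable0 (sT _ _)).
have TE x : T C (g |: G) x -> E x.
  by move=> Tx; exists 0, x; rewrite add0r; split=> //; exact: (dstable0 (sL _)).
have LgE x : locS (C :|: G) x -> E (x / lF g).
  move=> /(localizationU form_neq0 x dCG)[z [k [Lz ->]]].
  have [s] := ubnP (\sum_(i in C) k i); elim: s z k Lz => // s IH z k Lz ks.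
  have [/exists_inP[j jC /eqP kj]|k0] := boolP [exists j in C, k j == 0%N].
    apply/TE/(lower_poles_incl jC)/(localization_div form_neq0);
      first by rewrite !inE eqxx !orbT.
    rewrite (pole_monomial_drop l C kj).
    have dCj : [disjoint C :\ j & g |: G].
      rewrite disjoint_sym finset.disjoints_subset; apply/fintype.subsetP => i; rewrite !inE.
      case: eqVneq => [->|_] /=; first by rewrite (negPf gC) andbF.
      by move=> iG; rewrite (disjointFl dCG iG) andbF.
    apply/(localizationU form_neq0 _ dCj); exists z, k; split=> //.
    by apply: (localization_mono form_neq0) Lz; exact: finset.subsetUr.
  have Lzr := Lr z Lz.
  have -> : z * ypow k C / lF g = z / r * ypow k C -
      \sum_(i in C) frac_const n (a i) * (z / r * (lF i * ypow k C) / lF g).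
    rewrite [X in _ - X](_ : _ = z / r * ypow k C * (lF g - r) / lF g); last first.
      have -> : lF g - r = \sum_(i in C) frac_const n (a i) * lF i.
        by rewrite Eg [r + _]addrC addrK.
      rewrite mulr_sumr mulr_suml; apply: eq_bigr => i _.
      by move: (lF g)^-1 (frac_const n _) (ypow _ _) (r^-1) => u1 u2 u3 u4; ring.
    move: (lF g) (lF0 g) (ypow k C) => u u0 y; rewrite mulrBr mulrBl (mulfK u0).
    by rewrite opprB [RHS]addrC subrK [z / r * y * r]mulrAC (mulfVK r0).
  apply: (dstableB sE); first by apply/LE/(localizationU form_neq0 _ dCG); exists (z / r), k.
  apply: (@dstable_sum _ _ _ _ _ _ _ sE) => j jC; apply: dstableM => //.
  have kj : (0 < k j)%N by rewrite lt0n; apply/negP => kj; case/exists_inP: k0; exists j.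
  have [k' kE sk'] := exponent_decr jC kj.
  rewrite (@pole_monomial_mul _ _ _ _ form_neq0 j k' k) //; apply: IH => //.
  by move: ks; rewrite sk' ltnS.
have EgE x : E x -> E (x / lF g).
  move=> [u [v [Lu Tv ->]]]; rewrite mulrDl; apply: (dstableD sE); first exact: LgE.
  by apply/TE/(lower_poles_div form_neq0) => //; rewrite !inE eqxx.
apply/seteqP; split=> [_ [u [v [Lu Tv ->]]]|x].
  apply: (dstableD (sL _)); last exact: lower_poles_sub form_neq0 _ _ _ Tv.
  by apply: (localization_mono form_neq0) Lu; apply: finset.setUS; exact: finset.subsetUr.
have dg : [disjoint [set g]%SET & C :|: G].
  by rewrite disjoints1 !inE negb_or gC gG.
rewrite finset.setUCA => /(localizationU form_neq0 _ dg)[z [k [Lz ->]]].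
rewrite /pole_monomial big_set1; elim: (k g) => [|j IH]; first by rewrite invr1 mulr1;
  exact: LE.
by rewrite exprSr invfM mulrA; exact: EgE.
Qed.

(** If the linear part of [l g] vanishes on the tangent space, it is determined by its
    values at the dual vectors, hence a combination of the linear parts of the forms of
    [C]; then [l g] is constant on their common zeros. *)
Lemma tangent_or_combination (C : {set 'I_m}) d g : dual_vectors C d ->
  (exists2 e, (forall i, i \in C -> linpart (l i) e = 0) & linpart (l g) e = 1) \/
  exists c, l g = c%:MP + \sum_(i in C) linpart (l g) (d i) *: l i.
Proof.
move=> dC; pose v := tangent_vec C d.
have vC a i : i \in C -> linpart (l i) (v a) = 0 by exact: linpart_tangent_vec.
have [/existsP[a ga]|g0] := boolP [exists a, linpart (l g) (v a) != 0].
  left; exists ((linpart (l g) (v a))^-1 *: v a); last by rewrite linpartZ mulVf.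
  by move=> i iC; rewrite linpartZ (vC a i iC) mulr0.
right; pose p := l g - \sum_(i in C) linpart (l g) (d i) *: l i.
exists p@_0; suff -> : (p@_0)%:MP = p by rewrite subrK.
have p2 : (msize p <= 2)%N.
  apply/msize_leP => k k2; rewrite mcoeffB raddf_sum /=.
  have /msize_leP -> // := form_le2 g; rewrite big1 ?subr0 // => i _.
  by rewrite mcoeffZ; have /msize_leP -> // := form_le2 i; rewrite mulr0.
rewrite [RHS](affine_expand p2) big1 ?addr0 // => a _.
suff -> : p@_U_(a) = 0 by rewrite scale0r.
have : linpart (l g) (v a) = 0 by apply: contraNeq g0 => ga; apply/existsP; exists a.
rewrite /v /tangent_vec linpartD -scaleN1r linpartZ linpart_sum mulN1r linpart_delta => <-.
rewrite mcoeffB raddf_sum; congr (_ - _); apply: eq_bigr => i _ /=.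
by rewrite mcoeffZ linpartZ linpart_delta mulrC.
Qed.

Lemma dual_vectors_extend (C : {set 'I_m}) d g e : dual_vectors C d ->
  (forall i, i \in C -> linpart (l i) e = 0) -> linpart (l g) e = 1 ->
  exists d', dual_vectors (g |: C) d'.
Proof.
move=> dC eC eg; have gC : g \notin C.
  by apply/negP => /eC; rewrite eg => /eqP; rewrite oner_eq0.
have neqg i : i \in C -> (i == g) = false by move=> iC; apply: contraNF gC => /eqP <-.
exists (fun j => if j == g then e else d j - linpart (l g) (d j) *: e).
move=> i j; rewrite !inE => /predU1P[->|iC] /predU1P[->|jC]; rewrite ?eqxx //.
- by rewrite neqg // eq_sym neqg // linpartD -scaleN1r !linpartZ eg mulr1 mulN1r subrr.
- by rewrite neqg // eC.
- by rewrite neqg // linpartD -scaleN1r !linpartZ eC // !mulr0 addr0 dC.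
Qed.

Lemma combination_vanishes (C : {set 'I_m}) (a : 'I_m -> K) g :
  l g = \sum_(i in C) a i *: l i -> vanishes C g.
Proof.
move=> Eg x Xx; rewrite /zero_locus /= Eg raddf_sum big1 // => i iC /=.
by rewrite mevalZ Xx // mulr0.
Qed.

(** The case of degree one, and of an affine subspace, of the Nullstellensatz *)
Lemma vanishes_combination (C : {set 'I_m}) d g : dual_vectors C d -> vanishes C g ->
  l g = \sum_(i in C) linpart (l g) (d i) *: l i.
Proof.
move=> dC Cg; have [x Xx] := common_zeros_neq0 dC.
have [[e eC eg]|[c E]] := tangent_or_combination g dC.
  have /Cg : common_zeros C (x + e) by move=> i iC; rewrite meval_affineD // Xx // eC // addr0.
  rewrite /zero_locus /= meval_affineD // (Cg x Xx) eg add0r => /eqP.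
  by rewrite oner_eq0.
suff c0 : c = 0 by rewrite [LHS]E c0 add0r.
have := Cg x Xx; rewrite /zero_locus /= E mevalD mevalC raddf_sum /= big1 ?addr0 //.
by move=> i iC; rewrite mevalZ Xx // mulr0.
Qed.

(** * Counting subarrangements *)

(** Up to sign, the coefficient that belongs to [X] in Whitney's formula for the
    arrangement cut out by [G] on the flat of [C] *)
Definition signed_count (C G : {set 'I_m}) (X : set V) : int :=
  \sum_(B : {set 'I_m} | B \subset G) (-1) ^+ #|B| *+ `[< common_zeros (C :|: B) = X >].

(** Deletion and restriction: the subsets of [g |: G] without and with [g] *)
Lemma signed_count_setU1 (C G : {set 'I_m}) g X : g \notin G ->
  signed_count C (g |: G) X = signed_count C G X - signed_count (g |: C) G X.
Proof.
move=> gG; rewrite /signed_count sum_subsets_setU1 // -sumrN; congr (_ + _).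
apply: eq_bigr => B BG; rewrite cardsU1 (contra _ gG) ?add1n ?exprS ?mulN1r; last first.
  exact: (fintype.subsetP BG).
by rewrite mulNrn finset.setUCA finset.setUA.
Qed.

Lemma common_zerosU (C B : {set 'I_m}) : common_zeros (C :|: B) =
  (common_zeros C `&` common_zeros B)%classic.
Proof.
apply/seteqP; split=> x.
  by move=> Xx; split=> i iC; apply: Xx; rewrite inE iC ?orbT.
by move=> [XC XB] i; rewrite inE => /orP[]; [exact: XC|exact: XB].
Qed.

Lemma vanishes_setU1 (C : {set 'I_m}) g : vanishes C g -> common_zeros (g |: C) =
  common_zeros C.
Proof.
move=> Cg; apply/seteqP; split=> x Xx i; first by move=> iC; apply: Xx; rewrite inE iC orbT.
by rewrite !inE => /predU1P[->|]; [exact: Cg|exact: Xx].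
Qed.

(** Subsets with and without [g] cancel, since they cut out the same flat. *)
Lemma signed_count_vanishes (C G : {set 'I_m}) g X : g \in G -> vanishes C g ->
  signed_count C G X = 0.
Proof.
move=> gG Cg; rewrite -(finset.setD1K gG) signed_count_setU1 ?inE ?eqxx //.
rewrite /signed_count -sumrB big1 // => B _.
by rewrite (common_zerosU C) (common_zerosU (g |: C)) vanishes_setU1 // subrr.
Qed.

Lemma signed_count_empty (C G : {set 'I_m}) X : common_zeros C = classical_sets.set0 ->
  (X !=set0)%classic -> signed_count C G X = 0.
Proof.
move=> C0 [x Xx]; apply: big1 => B _; rewrite common_zerosU C0 classical_sets.set0I.
by rewrite (_ : `[< _ >] = false) //; apply/asboolP => E; move: Xx; rewrite -E.
Qed.

Lemma signed_count0 (C : {set 'I_m}) X : signed_count C set0 X = (`[< common_zeros C = X >])%:R.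
Proof.
rewrite /signed_count (big_pred1 set0) => [|B]; last by rewrite finset.subset0.
by rewrite cards0 expr0 finset.setU0.
Qed.

(** The direction of the flat is the kernel of the linear map given by the linear parts
    of the forms of [C], which the dual vectors show to be onto. *)
Lemma codim_common_zeros (C : {set 'I_m}) d : dual_vectors C d -> codim (common_zeros C) = #|C|.
Proof.
move=> dC; pose M : 'M[K]_(n, #|C|) := \matrix_(a, j) (l (enum_val j))@_U_(a).
have ME (v : V) j : (v *m M) 0 j = linpart (l (enum_val j)) v.
  by rewrite mxE; apply: eq_bigr => a _; rewrite mxE.
pose phi : 'Hom(V, 'rV[K]_#|C|) := linfun (mulmxr M).
have X0 := common_zeros_neq0 dC.
have XE x v : common_zeros C x -> common_zeros C (x + v) <-> forall i, i \in C ->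
  linpart (l i) v = 0.
  move=> Xx; split=> H i iC; last by rewrite meval_affineD // Xx // H // addr0.
  by have := H i iC; rewrite meval_affineD // Xx // add0r.
have Xaff (c : K) x y z : common_zeros C x -> common_zeros C y -> common_zeros C z ->
    common_zeros C (x + c *: (y - z)).
  move=> Xx Xy Xz; apply/XE => // i iC; rewrite linpartZ.
  have /XE -> // : common_zeros C (z + (y - z)) by rewrite addrC subrK.
  by rewrite mulr0.
have dirE : direction (common_zeros C) = lker phi.
  apply/vspaceP => v; apply/idP/idP.
    move/(directionP X0 Xaff) => [x [y [Xx Xy ->]]]; rewrite memv_ker lfunE /=;
      apply/eqP/rowP => j.
    rewrite ME mxE; have /XE -> // : common_zeros C (y + (x - y)) by rewrite addrC subrK.
    exact: enum_valP.
  rewrite memv_ker lfunE /= => /eqP vM; apply/(directionP X0 Xaff).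
  have [x Xx] := X0; exists (x + v), x; split=> //; last by rewrite addrC addKr.
  apply/XE => // i iC; rewrite -(enum_rankK_in iC iC) -ME vM mxE //.
have imE : limg phi = fullv.
  apply/vspaceP => w; rewrite memvf; apply/memv_imgP.
  exists (\sum_j w 0 j *: d (enum_val j)); first exact: memvf.
  rewrite lfunE /=; apply/rowP => j; rewrite ME linpart_sum (bigD1 j) //=.
  rewrite linpartZ dC ?enum_valP // eqxx mulr1 big1 ?addr0 // => k kj.
  by rewrite linpartZ dC ?enum_valP // (inj_eq enum_val_inj) eq_sym (negPf kj) mulr0.
have := limg_ker_dim phi fullv; rewrite capfv imE !dimvf /dim /= !mul1n -dirE => E.
by rewrite /codim -[X in (X - _)%N]E addKn.
Qed.

Lemma flat_of_common_zeros (C : {set 'I_m}) : (common_zeros C !=set0)%classic ->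
  exists X : flat A, flat_set X = common_zeros C.
Proof.
move=> X0; have XA : common_zeros C \in intersections A.
  apply/intersectionsP; split=> //.
  exists [fset zero_locus (l i) | i in C]%fset.
    by apply/fsubsetP => _ /imfsetP[i _ ->]; apply/imfsetP; exists i.
  apply/seteqP; split=> x.
    by move=> Xx H /= /imfsetP[i /= iC ->]; exact: Xx.
  move=> H i iC; apply: (H (zero_locus (l i))) => /=; apply/imfsetP; by exists i.
by exists [` XA]%fset.
Qed.

Lemma flat_neq0 (X : flat A) : (flat_set X !=set0)%classic.
Proof. by have /intersectionsP[] := fsvalP X. Qed.

Lemma flat_set_inj : injective (@flat_set K n A).
Proof. exact: val_inj. Qed.

(** * The length of localized delta-modules *)

(** Left exactness of the sequence [0 -> Q C G -> Q C (g |: G)], with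
    [Q C G] the quotient of [locS (C :|: G)] by [T C G] *)
Lemma chain_exact (C : {set 'I_m}) d g (G : {set 'I_m}) k : dual_vectors C d ->
  (forall h, h \in g |: G -> ~ vanishes C h) -> chain (T C G) (locS (C :|: G)) k ->
  chain (T C (g |: G)) (sum_set (locS (C :|: G)) (T C (g |: G))) k.
Proof.
move=> dC CG Lk; apply: chain_sum_set => //.
by rewrite (lower_poles_cap dC (finset.subsetUr _ _) CG).
Qed.

Lemma tofracZ (c : K) (p : R) : (c *: p)%:F = frac_const n c * p%:F.
Proof. by rewrite -mul_mpolyC tofracM. Qed.

Lemma form_frac_combination (C : {set 'I_m}) (a : 'I_m -> K) :
  (\sum_(i in C) a i *: l i)%:F = \sum_(i in C) frac_const n (a i) * lF i.
Proof.
rewrite (raddf_sum (@FracField.tofrac R)); apply: eq_bigr => i _; exact: tofracZ.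
Qed.

(** The degenerate case of deletion-restriction: on the flat of [C], [l g] agrees with a
    nonzero constant or is proportional to some [l h] with [h] in [G] that vanishes on
    its zeros there.  Both are invertible once [G] is inverted. *)
Lemma localization_add_dependent (C : {set 'I_m}) d g (G : {set 'I_m}) : dual_vectors C d ->
  g \notin G -> (forall h, h \in g |: G -> ~ vanishes C h) ->
  (forall e, (forall i, i \in C -> linpart (l i) e = 0) -> linpart (l g) e = 1 ->
     exists2 h, h \in G & vanishes (g |: C) h) ->
  sum_set (locS (C :|: G)) (T C (g |: G)) = locS (C :|: (g |: G)).
Proof.
move=> dC gG CG dep.
have gC : g \notin C.
  by apply/negP => gC; apply: (CG g); [rewrite !inE eqxx|exact: vanishes_mem].
have dCG : [disjoint C & G].
  by apply: nonvanishing_disjoint => h hG; apply: (CG h); rewrite !inE hG orbT.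
have [[e eC eg]|[c Ec]] := tangent_or_combination g dC.
  have [h hG gh] := dep e eC eg; have [d' dgC] := dual_vectors_extend dC eC eg.
  have := vanishes_combination dgC gh; rewrite big_setU1 //=.
  set b := linpart (l h) (d' g) => Eh.
  have b0 : b != 0.
    apply/eqP => b0; apply: (CG h); first by rewrite !inE hG orbT.
    by apply: (combination_vanishes (a := fun i => linpart (l h) (d' i)));
      rewrite {1}Eh b0 scale0r add0r.
  apply: (@localization_add_unit C G g (frac_const n b^-1 * lF h)
    (fun i => - (b^-1 * linpart (l h) (d' i)))) => //.
  - by apply: mulf_neq0; [rewrite fmorph_eq0 invr_eq0|exact: lF0].
  - move=> z Lz; rewrite invfM -fmorphV invrK mulrCA; apply: (dstableM (sL G)).
    exact: localization_div.
  have -> : frac_const n b^-1 * lF h =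
      frac_const n b^-1 * (frac_const n b * lF g +
        \sum_(i in C) frac_const n (linpart (l h) (d' i)) * lF i).
    by have := congr1 (@FracField.tofrac R) Eh;
      rewrite tofracD tofracZ form_frac_combination => <-.
  rewrite mulrDr mulrA -rmorphM mulVf // rmorph1 mul1r mulr_sumr -addrA -big_split.
  rewrite big1 ?addr0 // => i _ /=.
  by rewrite mulrA -rmorphM -mulrDl -rmorphD subrr rmorph0 mul0r.
have c0 : c != 0.
  apply/eqP => c0; apply: (CG g); first by rewrite !inE eqxx.
  by apply: (combination_vanishes (a := fun i => linpart (l g) (d i))); rewrite {1}Ec c0 add0r.
apply: (@localization_add_unit C G g (frac_const n c) (fun i => linpart (l g) (d i))) => //.
- by rewrite fmorph_eq0.
- by move=> z Lz; rewrite mulrC -fmorphV; exact: (dstableM (sL G)).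
by have := congr1 (@FracField.tofrac R) Ec; rewrite tofracD form_frac_combination => <-.
Qed.

(** The deletion-restriction recursions for the length and for [signed_count] run in
    parallel.  The sign absorbs the minus sign of the second one, because passing from
    [C] to [g |: C] changes the parity of [#|C|]. *)
Lemma length_delta_module (G C : {set 'I_m}) d : dual_vectors C d ->
  (forall g, g \in G -> ~ vanishes C g) ->
  exists w : flat A -> nat, chain (T C G) (locS (C :|: G)) (\sum_X w X) /\
    forall X, signed_count C G (flat_set X) =
      (-1) ^+ (codim (flat_set X) + #|C|) * (w X)%:Z.
Proof.
have [k] := ubnP #|G|; elim: k G C d => // k IH G C d Gk dC CG.
have [G0|[g gG]] := set_0Vmem G.
  exists (fun X => `[< common_zeros C = flat_set X >] : nat).
  have [X0 X0E] := flat_of_common_zeros (common_zeros_neq0 dC).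
  rewrite (bigD1 X0) //= big1 => [|X XX0]; last first.
    apply/eqP; rewrite eqb0; apply: contra XX0 => /asboolP XE; apply/eqP.
    by apply: flat_set_inj; rewrite X0E.
  have -> : `[< common_zeros C = flat_set X0 >] by apply/asboolP.
  rewrite G0 finset.setU0 addn0; split.
    by apply: chain_cons (covers_lower_poles dC); apply: chain_nil; exact: sT.
  move=> X; rewrite signed_count0; case: asboolP => [<-|_]; last by rewrite mulr0.
  by rewrite (codim_common_zeros dC) addnn -muln2 exprM sqrr_sign mulr1.
pose G' := G :\ g; have GE : G = g |: G' by rewrite finset.setD1K.
have gG' : g \notin G' by rewrite !inE eqxx.
have G'k : (#|G'| < k)%N by move: Gk; rewrite GE cardsU1 gG'.
have CG' h : h \in G' -> ~ vanishes C h by move=> hG'; apply: CG; rewrite GE inE hG' orbT.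
have gC : g \notin C by apply/negP => gC; exact: (CG g gG (vanishes_mem gC)).
have [w1 [L1 S1]] := IH G' C d G'k dC CG'.
rewrite GE in CG *.
have [[e [eC eg ne]]|dep] := pselect (exists e, [/\ forall i, i \in C -> linpart (l i) e = 0,
    linpart (l g) e = 1 & ~ exists2 h, h \in G' & vanishes (g |: C) h]).
  have [d' dgC] := dual_vectors_extend dC eC eg.
  have [|w2 [L2 S2]] := IH G' (g |: C) d' G'k dgC; first by move=> h hG gh; apply: ne; exists h.
  exists (fun X => w1 X + w2 X)%N; split.
    rewrite big_split; apply: chain_cat (chain_exact dC CG L1) _.
    by rewrite lower_poles_add_pole // finset.setUCA finset.setUA.
  move=> X; rewrite signed_count_setU1 // S1 S2 cardsU1 gC addnCA add1n exprS PoszD mulrDr.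
  by rewrite mulN1r mulNr opprK.
exists w1; split.
  rewrite -(@localization_add_dependent C d g G') //; first exact: (chain_exact dC CG L1).
  move=> e eC eg; apply: contrapT => ne; apply: dep; by exists e.
move=> X; rewrite signed_count_setU1 // S1 [X in _ - X](_ : _ = 0) ?subr0 //.
have [[e eC eg]|[c Ec]] := tangent_or_combination g dC.
  have [h hG' gh] : exists2 h, h \in G' & vanishes (g |: C) h.
    by apply: contrapT => ne; apply: dep; exists e.
  exact: signed_count_vanishes gh.
apply: signed_count_empty (flat_neq0 X); apply/seteqP; split=> // x Xx.
apply: (CG g); first by rewrite !inE eqxx.
have /(congr1 (fun p => p.@[x 0])) := Ec.
rewrite mevalD mevalC raddf_sum big1 /= => [|i iC]; last first.
  by rewrite mevalZ (Xx i) ?mulr0 // inE iC orbT.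
rewrite (Xx g) ?inE ?eqxx // addr0 => c0.
by apply: (combination_vanishes (a := fun i => linpart (l g) (d i))); rewrite {1}Ec -c0 add0r.
Qed.

Lemma common_zeros0 : common_zeros set0 = setT.
Proof. by apply/seteqP; split=> // x _ i; rewrite inE. Qed.

Lemma dual_vectors0 d : dual_vectors set0 d.
Proof. by move=> i j; rewrite inE. Qed.

Lemma dual_vectors1 g : exists d, dual_vectors [set g]%SET d.
Proof.
have [[e eC eg]|[c Ec]] := tangent_or_combination g (dual_vectors0 (fun=> 0)).
  by have := dual_vectors_extend (dual_vectors0 (fun=> 0)) eC eg; rewrite finset.setU0.
by have := l_deg1 g; rewrite Ec big_set0 addr0 msizeC; case: (c != 0).
Qed.

(** The series has to pass through [R], whence the filtration of [R_G] by the
    localizations at smaller sets instead of the case of empty [C] above.  Since the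
    forms are pairwise not proportional, every step is a nondegenerate one, with
    quotient the delta-module along the zeros of [g], localized at [G']. *)
Lemma length_localization (l_nonprop : forall i j, i != j -> forall c : K, l i != c *: l j)
    (G : {set 'I_m}) :
  exists w : flat A -> nat, chain (@poly_set K n) (locS G) (\sum_X w X) /\
    forall X, signed_count set0 G (flat_set X) - (X == flatV A)%:R =
      (-1) ^+ codim (flat_set X) * (w X)%:Z.
Proof.
have [k] := ubnP #|G|; elim: k G => // k IH G Gk.
have [->|[g gG]] := set_0Vmem G.
  exists (fun=> 0%N); rewrite big1 //; split.
    have L0 : locS set0 = @poly_set K n by apply/seteqP; split=> x Hx;
      apply/(localization0 form_neq0).
    by rewrite L0; apply: chain_nil; rewrite -L0; exact: dstable_localization.
  move=> X; rewrite signed_count0 common_zeros0 mulr0.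
  suff -> : `[< setT = flat_set X >] = (X == flatV A) by rewrite subrr.
  apply/asboolP/eqP => [E|-> //].
  by apply: flat_set_inj; rewrite -E.
pose G' := G :\ g; have GE : G = g |: G' by rewrite finset.setD1K.
have gG' : g \notin G' by rewrite !inE eqxx.
have G'k : (#|G'| < k)%N by move: Gk; rewrite GE cardsU1 gG'.
have [w1 [L1 S1]] := IH G' G'k.
have [d dg] := dual_vectors1 g.
have [|w2 [L2 S2]] := @length_delta_module G' [set g]%SET d dg.
  move=> h hG' /(vanishes_combination dg); rewrite big_set1 => E.
  have hg : h != g by apply: contraNneq gG' => <-.
  by have := l_nonprop h g hg (linpart (l h) (d g)); rewrite -E eqxx.
exists (fun X => w1 X + w2 X)%N; split.
  rewrite big_split; apply: chain_cat L1 _.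
  (* a single form has nothing but its own pole to lose *)
  have -> : locS G' = T [set g]%SET G'.
    have := @lower_poles_add_pole _ _ _ l set0 G' g; rewrite inE => /(_ isT gG').
    rewrite finset.setU0 finset.set0U => <-; apply/seteqP; split=> x.
      by move=> Lx; exists x, 0; rewrite addr0; split=> //; apply: dstable0;
        exact: dstable_lower_poles.
    move=> [a [b [La [u [_ ->]] ->]]]; rewrite big_set0 addr0.
    exact: La.
  by rewrite GE.
move=> X; rewrite GE signed_count_setU1 // finset.setU0 addrAC S1 S2 cards1 addn1.
by rewrite exprS PoszD mulrDr mulN1r mulNr opprK.
Qed.

(** The left-hand side sums [(-1) ^ #|B|] over all sets [B] of hyperplanes containing
    [X]; this vanishes unless there is no such hyperplane. *)
Lemma sum_signed_count (X : flat A) :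
  \sum_(Z : flat A | (Z <= X)%O) signed_count set0 finset.setT (flat_set Z) =
  (X == flatV A)%:R.
Proof.
pose S := [set i : 'I_m | `[< (flat_set X `<=` zero_locus (l i))%classic >]]%SET.
have SP (B : {set 'I_m}) : (B \subset S) = `[< (flat_set X `<=` common_zeros B)%classic >].
  apply/fintype.subsetP/asboolP => [BS x Xx i iB|H i iB].
    by have := BS i iB; rewrite inE => /asboolP; apply.
  by rewrite inE; apply/asboolP => x /H; exact.
have -> : \sum_(Z : flat A | (Z <= X)%O) signed_count set0 finset.setT (flat_set Z) =
    \sum_(B : {set 'I_m} | B \subset S) (-1) ^+ #|B|.
  rewrite exchange_big /= big_mkcond [RHS]big_mkcond; apply: eq_bigr => B _.
  rewrite finset.subsetT SP finset.set0U.
  case: asboolP => [XB|XB]; last first.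
    rewrite big1 // => Z /asboolP XZ; case: asboolP => // E.
    by case: XB; rewrite E.
  have [x Xx] := flat_neq0 X.
  have [Z ZE] : exists Z : flat A, flat_set Z = common_zeros B.
    by apply: flat_of_common_zeros; exists x; exact: XB.
  rewrite (bigD1 Z) /=; last by apply/asboolP; rewrite ZE.
  rewrite -ZE (_ : `[< _ >] = true); last by apply/asboolP.
  rewrite big1 ?addr0 // => Y /andP[_ YZ].
  rewrite (_ : `[< _ >] = false) //; apply/asboolP => E.
  by case/eqP: YZ; apply: flat_set_inj.
have [S0|[i iS]] := set_0Vmem S.
  rewrite S0 (big_pred1 set0) => [|B]; last by rewrite finset.subset0.
  rewrite cards0 expr0; case: eqP => // XV; case: XV; apply: flat_set_inj.
  have /intersectionsP[_ [B BA]] := fsvalP X; rewrite -/(flat_set X) => XB.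
  suff B0 : B = fset0 by rewrite XB B0 set_fset0 bigcap_set0.
  apply/eqP; rewrite -fsubset0; apply/fsubsetP => H HB.
  have /imfsetP[i _ Hi] := fsubsetP BA _ HB.
  have : i \in S.
    rewrite inE; apply/asboolP; rewrite XB -Hi => x Bx; exact: (Bx H HB).
  by rewrite S0 finset.in_set0.
rewrite -(finset.setD1K iS) sum_subsets_setU1 ?inE ?eqxx // -big_split big1 /= => [|B BS].
  case: eqP => // XV; move: iS; rewrite inE => /asboolP H.
  have := l_deg1 i; have [d di] := dual_vectors1 i.
  have V0 : common_zeros [set i]%SET = setT.
    apply/seteqP; split=> // x _ j; rewrite inE => /eqP ->; apply: H.
    by rewrite XV.
  have := codim_common_zeros di;
    rewrite V0 -common_zeros0 (codim_common_zeros (dual_vectors0 d)).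
  by rewrite cards0 cards1.
have iB : i \notin B.
  by apply/negP => /(fintype.subsetP BS); rewrite !inE eqxx.
by rewrite cardsU1 iB exprS mulN1r subrr.
Qed.

(** Whitney's theorem: [signed_count] satisfies the recursion that defines the Moebius
    function. *)
Lemma mu_signed_count (X : flat A) : mu X = signed_count set0 finset.setT (flat_set X).
Proof.
have VX (Y : flat A) : (flatV A <= Y)%O by apply/asboolP.
have [k] := ubnP #|[pred Z : flat A | (Z < X)%O]|; elim: k X => // k IH X Xk.
have := sum_signed_count X; rewrite (bigD1 X) //=.
rewrite (eq_bigl (fun Z : flat A => (Z < X)%O)); last first.
  by move=> Z; rewrite lt_neqAle andbC.
rewrite (eq_bigr (fun Z : flat A => mu Z)); last first.
  move=> Z ZX; rewrite IH //; rewrite ltnS in Xk; apply: leq_trans Xk; apply: proper_card.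
  apply/properP; split; first by apply/fintype.subsetP => Y; rewrite !inE => /lt_trans ->.
  by exists Z; rewrite !inE // ltxx.
case: eqVneq => [->|XV].
  rewrite /mu moebius_refl big1 ?addr0 // => Z; rewrite lt_neqAle => /andP[/eqP ZV ZV'].
  by case: ZV; apply: le_anti; rewrite ZV' VX.
move/eqP; rewrite addr_eq0 => /eqP ->; rewrite /mu moebius_lt.
  by congr (- _); apply: eq_bigl => Z; rewrite VX.
by rewrite lt_neqAle eq_sym XV VX.
Qed.

End Arrangements.

Theorem theorem3p2 (K : fieldType) (charK : [pchar K] =i pred0) (n m : nat)
    (l : 'I_m -> {mpoly K[n]})
    (l_deg1 : forall i, msize (l i) = 2%N)
    (l_nonprop : forall i j, i != j -> forall c : K, l i != c *: l j)
    (f : {mpoly K[n]}) (f_prod : f = \prod_(i < m) l i) :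
  let A := arrangement l in
  exists k : nat,
    [/\ has_length (local_cohomology1 f) k,
        k%:Z = (poincare A).[1] - 1
      & (poincare A).[1] - 1 = \sum_(X : flat A | X != flatV A) `|mu X| ].
Proof.
move=> A; have [w [Lw Sw]] := length_localization charK l_deg1 l_nonprop finset.setT.
have muE (X : flat A) : mu X = (X == flatV A)%:R + (-1) ^+ codim (flat_set X) * (w X)%:Z.
  by rewrite -Sw -mu_signed_count // addrC subrK.
have codimV : codim (flat_set (flatV A)) = 0%N.
  have := codim_common_zeros l_deg1 (dual_vectors0 l (fun=> 0));
    rewrite common_zeros0 cards0; exact.
have wV : w (flatV A) = 0%N.
  have := muE (flatV A); rewrite codimV expr0 mul1r /mu moebius_refl eqxx => H.
  have : (w (flatV A))%:Z = 0 by apply: (addrI 1); rewrite -H addr0.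
  by case.
have poinE : (poincare A).[1] - 1 = (\sum_X w X)%N%:Z.
  rewrite /poincare horner_sum (bigD1 (flatV A)) //=.
  rewrite hornerZ codimV expr0 hornerC mulr1 /mu moebius_refl addrAC subrr add0r.
  rewrite [in RHS](bigD1 (flatV A)) //= wV add0n -natz natr_sum; apply: eq_bigr => X XV.
  rewrite hornerZ horner_exp hornerN hornerX -/(mu X) muE (negPf XV) add0r.
  by rewrite mulrAC -exprMn mulrNN mulr1 expr1n mul1r natz.
exists (\sum_X w X)%N; split=> //.
  apply: has_length_local_cohomology; rewrite f_prod.
  suff -> : \prod_(i < m) l i = \prod_(i in [set: 'I_m]%SET) l i by [].
  by apply: eq_bigl => i; rewrite inE.
rewrite poinE (bigD1 (flatV A)) //= wV add0n -natz natr_sum; apply: eq_bigr => X XV.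
by rewrite muE (negPf XV) add0r normrM normrX normrN1 expr1n mul1r natz.
Qed.
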